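(* Let $(\Omega,d)$ be a non-degenerate strongly finite-dimensional $*$-differential calculus of dimension $N$ over a Hopf $*$-algebra $\mathcal{A}$ admitting a Haar integral. Suppose that $\dim(\Omega^{\mathrm{inv}}_N)=1$ and $d(\Omega^{\mathrm{inv}}_{N-1})=0$. Then $\Omega^{\mathrm{inv}}$ admits a graded inner product such that, for the induced graded, left-invariant inner product on $\Omega$, the corresponding Hodge operator $L$ is a unitary and satisfies the following conditions: 1. $L^2(\omega)=(-1)^{k(N-k)}\omega$ for all $\omega\in\Omega_k$; 2. $Ld(\omega)=(-1)^{k+1}d^*L(\omega)$ for all $\omega\in\Omega_k$; 3. $d^*dL=Ldd^*$, $dd^*L=Ld^*d$ and $L\nabla=\nabla L$.
   Context: All spaces are over $\mathbb{C}$; inner products are linear in the first variable. $(\mathcal{A},\Delta)$ is a Hopf $*$-algebra. A graded $*$-algebra is an algebra $\Omega=\bigoplus_{n\ge 0}\Omega_n$ with $\Omega_m\Omega_n\subseteq\Omega_{m+n}$ and a conjugate-linear degree-zero map $\omega\mapsto\omega^*$ with $(\omega^* )^*=\omega$ and $(\omega_1\omega_2)^*=(-1)^{kl}\omega_2^*\omega_1^*$ for $\omega_1\in\Omega_k,\omega_2\in\Omega_l$. A graded $*$-differential algebra is a pair $(\Omega,d)$ with $\Omega$ a graded $*$-algebra and $d$ a linear map of degree $1$ with $d^2=0$, $d(\omega^* )=(d\omega)^*$ and $d(\omega'\omega)=d(\omega')\omega+(-1)^k\omega'd\omega$ for $\omega'\in\Omega_k$. A $*$-differential calculus over $\mathcal{A}$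 is a graded $*$-differential algebra $(\Omega,d)$ such that: (1) $\Omega_0=\mathcal{A}$ as $*$-algebras and $\Omega_k$ ($k>0$) is the linear span of products $a_0\,da_1\cdots da_k$, $a_i\in\mathcal{A}$; (2) there is an algebra homomorphism $\Delta_\Omega:\Omega\to\mathcal{A}\otimes\Omega$ extending $\Delta$ with $(\mathrm{id}_{\mathcal{A}}\otimes d)\Delta_\Omega=\Delta_\Omega d$; (3) $d1=0$. $\Omega^{\mathrm{inv}}=\{\omega:\Delta_\Omega(\omega)=1\otimes\omega\}$, $\Omega^{\mathrm{inv}}_k=\Omega_k\cap\Omega^{\mathrm{inv}}$; $a\otimes\omega\mapsto a\omega$ is an isomorphism of left $\mathcal{A}$-modules $\mathcal{A}\otimes\Omega^{\mathrm{inv}}\to\Omega$, used as an identification. The calculus is strongly finite dimensional if $\dim\Omega^{\mathrm{inv}}<\infty$; its dimension is the $N$ with $\Omega_N\ne0$, $\Omega_k=0$ for $k>N$. It is non-degenerate if, whenever $0\le k\le N$, $\omega\in\Omega_k$ and $\omega'\omega=0$ for all $\omega'\in\Omega_{N-k}$, then $\omega=0$. A Haar integral is a unital positive linear functional $h$ on $\mathcal{A}$ ($h(a^*a)\ge0$) with $(\mathrm{id}\otimes h)\Delta(a)=(h\otimes\mathrm{id})\Delta(a)=h(a)1$; it is unique and faithful. An inner product on $\Omega^{\mathrm{inv}}$ is graded if the $\Omega^{\mathrm{inv}}_k$ are pairwise orthogonal; it induces on $\Omega=\mathcal{A}\otimes\Omega^{\mathrm{inv}}$ the inner product $(a\omega\mid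 b\eta)=h(b^*a)(\omega\mid\eta)$ ($a,b\in\mathcal{A}$, $\omega,\eta\in\Omega^{\mathrm{inv}}$). With respect to it $d$ has an adjoint $d^*$ on $\Omega$, and $\nabla=(d+d^* )^2=dd^*+d^*d$. A volume element is a unit vector $\theta\in\Omega^{\mathrm{inv}}_N$ with $\theta^*=\theta$ (unique up to sign). The associated integral $\int$ is the linear functional on $\Omega$ with $\int\omega=0$ for $\omega\in\Omega_k$, $k<N$, and $\int a\theta=h(a)$ for $a\in\mathcal{A}$. The Hodge operator corresponding to the inner product (and $\theta$) is the unique left $\mathcal{A}$-linear (bijective) operator $L$ on $\Omega$ with $L(\Omega_k)=\Omega_{N-k}$ for $0\le k\le N$ and $\int\omega^*L(\omega')=(\omega'\mid\omega)$ for all $\omega,\omega'\in\Omega$. Unitary means bijective and inner-product preserving on $\Omega$. *)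

(* Defs.v *)
From HB Require Import structures.
From mathcomp Require Import all_boot all_order all_algebra.
From mathcomp Require Import boolp classical_sets reals.
From mathcomp Require Export complex.

Set Implicit Arguments.
Unset Strict Implicit.
Unset Printing Implicit Defensive.

Import Order.TTheory GRing.Theory Num.Theory.
Local Open Scope quotient_scope.
Local Open Scope classical_set_scope.
Local Open Scope ring_scope.

(* Algebraic tensor product of two modules over a commutative ring: formal sums
   of pairs modulo the congruence generated by bilinearity. *)

Inductive tens_rel (K : comNzRingType) (V W : lmodType K) :
    seq (V * W) -> seq (V * W) -> Prop :=
| tens_refl s : tens_rel s s
| tens_sym s t : tens_rel s t -> tens_rel t s
| tens_trans s t u : tens_rel s t -> tens_rel t u -> tens_rel s u
| tens_cat s s' t t' :
    tens_rel s s' -> tens_rel t t' -> tens_rel (s ++ t) (s' ++ t')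
| tens_comm s t : tens_rel (s ++ t) (t ++ s)
| tens_addl v v' w : tens_rel [:: (v + v', w)] [:: (v, w); (v', w)]
| tens_addr v w w' : tens_rel [:: (v, w + w')] [:: (v, w); (v, w')]
| tens_scale c v w : tens_rel [:: (c *: v, w)] [:: (v, c *: w)]
| tens_zero w : tens_rel [:: (0, w)] [::].

Section TensorQuotient.
Context {K : comNzRingType} {V W : lmodType K}.

Definition tens_relb (s t : seq (V * W)) : bool := `[< tens_rel s t >].

Lemma tens_relb_equiv : equiv_class_of tens_relb.
Proof.
split=> [s|s t|t s u].
- exact/asboolP/tens_refl.
- by apply/asboolP/asboolP; apply: tens_sym.
- by move=> /asboolP st /asboolP tu; apply/asboolP/(tens_trans st tu).
Qed.

Canonical tens_equiv_rel := EquivRelPack tens_relb_equiv.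

Definition tens := {eq_quot tens_equiv_rel}.
HB.instance Definition _ := Choice.on tens.
HB.instance Definition _ := EqQuotient.on tens.

End TensorQuotient.
Arguments tens {K} V W.

Section TensorModule.
Context {K : comNzRingType} {V W : lmodType K}.
Implicit Types (t u : tens V W) (s : seq (V * W)).

Definition tclass (s : seq (V * W)) : tens V W := \pi_(tens V W) s.

Lemma tclass_eq s s' : tens_rel s s' -> tclass s = tclass s'.
Proof. by move=> ss'; rewrite /tclass; apply/eqquotP/asboolP. Qed.

Lemma tclassK t : tclass (repr t) = t.
Proof. exact: reprK. Qed.

Lemma repr_tclass s : tens_rel (repr (tclass s)) s.
Proof.
have /eqquotP/asboolP // : repr (tclass s) = s %[mod tens V W].
exact: reprK.
Qed.

Lemma tclassW (P : tens V W -> Prop) : (forall s, P (tclass s)) -> forall t, P t.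
Proof. by move=> PP t; rewrite -[t]tclassK. Qed.

Definition tpure (v : V) (w : W) : tens V W := tclass [:: (v, w)].
Definition tzero : tens V W := tclass [::].
Definition tadd t u : tens V W := tclass (repr t ++ repr u).
Definition tscale (c : K) t : tens V W :=
  tclass [seq (c *: p.1, p.2) | p <- repr t].
Definition topp t : tens V W := tscale (- 1) t.

Lemma tadd_class s s' : tadd (tclass s) (tclass s') = tclass (s ++ s').
Proof. by apply: tclass_eq; apply: tens_cat; apply: repr_tclass. Qed.

Let rel_scale c s s' : tens_rel s s' ->
  tens_rel [seq (c *: p.1, p.2) | p <- s] [seq (c *: p.1, p.2) | p <- s'].
Proof.
elim=> {s s'} /=.
- by move=> s; apply: tens_refl.
- by move=> s t _; apply: tens_sym.
- by move=> s t u _ st _; apply: tens_trans.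
- by move=> s s' t t' _ ss' _ tt'; rewrite !map_cat; apply: tens_cat.
- by move=> s t; rewrite !map_cat; apply: tens_comm.
- by move=> v v' w; rewrite scalerDr; apply: tens_addl.
- by move=> v w w'; apply: tens_addr.
- by move=> d v w; rewrite scalerA mulrC -scalerA; apply: tens_scale.
- by move=> w; rewrite scaler0; apply: tens_zero.
Qed.

Lemma tscale_class c s :
  tscale c (tclass s) = tclass [seq (c *: p.1, p.2) | p <- s].
Proof. by apply: tclass_eq; apply: rel_scale; apply: repr_tclass. Qed.

Fact taddA : associative tadd.
Proof.
elim/tclassW=> s; elim/tclassW=> s'; elim/tclassW=> s''.
by rewrite !tadd_class catA.
Qed.

Fact taddC : commutative tadd.
Proof.
elim/tclassW=> s; elim/tclassW=> s'; rewrite !tadd_class.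
exact/tclass_eq/tens_comm.
Qed.

Fact tadd0 : left_id tzero tadd.
Proof. by elim/tclassW=> s; rewrite tadd_class. Qed.

Fact taddN : left_inverse tzero topp tadd.
Proof.
elim/tclassW=> s; rewrite /topp tscale_class tadd_class; apply: tclass_eq.
elim: s => [|[v w] s IHs]; first exact: tens_refl.
set s' := map _ s in IHs *; rewrite /= -/s'.
have /tens_trans : tens_rel (([:: (-1 *: v, w)] ++ s') ++ [:: (v, w)] ++ s)
    ([:: (-1 *: v, w); (v, w)] ++ (s' ++ s)).
  rewrite -[X in X ++ (s' ++ s)]/([:: (-1 *: v, w)] ++ [:: (v, w)]) -!catA.
  apply: tens_cat (tens_refl _) _; rewrite !catA.
  exact: tens_cat (tens_comm _ _) (tens_refl _).
apply; apply: (@tens_cat _ _ _ _ [::] _ [::] _ IHs).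
apply: tens_trans (tens_sym (tens_addl _ _ _)) _.
by rewrite scaleN1r addNr; apply: tens_zero.
Qed.

HB.instance Definition _ :=
  GRing.isZmodule.Build (tens V W) taddA taddC tadd0 taddN.

Lemma tclass0 : tclass [::] = 0. Proof. by []. Qed.

Lemma tclass_cat s s' : tclass (s ++ s') = tclass s + tclass s'.
Proof. by rewrite -tadd_class. Qed.

Lemma tclass_cons p s : tclass (p :: s) = tpure p.1 p.2 + tclass s.
Proof. by rewrite -cat1s tclass_cat; case: p. Qed.

Fact tscaleA a b t : tscale a (tscale b t) = tscale (a * b) t.
Proof.
elim/tclassW: t => s; rewrite !tscale_class -map_comp; congr (tclass _).
by apply: eq_map => p /=; rewrite scalerA.
Qed.

Fact tscale1 : left_id 1 tscale.
Proof.
elim/tclassW=> s; rewrite tscale_class; congr (tclass _).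
by rewrite -[RHS]map_id; apply: eq_map => -[v w] /=; rewrite scale1r.
Qed.

Fact tscaleDr : right_distributive tscale +%R.
Proof.
move=> c; elim/tclassW=> s; elim/tclassW=> s'.
by rewrite -tclass_cat !tscale_class map_cat tclass_cat.
Qed.

Lemma tpureDl w : {morph tpure^~ w : v v' / v + v'}.
Proof. by move=> v v'; rewrite -tclass_cat; apply/tclass_eq/tens_addl. Qed.

Lemma tpureDr v : {morph tpure v : w w' / w + w'}.
Proof. by move=> w w'; rewrite -tclass_cat; apply/tclass_eq/tens_addr. Qed.

Fact tscaleDl t : {morph tscale^~ t : a b / a + b}.
Proof.
move=> a b; elim/tclassW: t => s; rewrite !tscale_class.
elim: s => [|p s IHs]; first by rewrite tclass0 addr0.
by rewrite !map_cons !tclass_cons IHs addrACA scalerDl tpureDl.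
Qed.

HB.instance Definition _ :=
  GRing.Zmodule_isLmodule.Build K (tens V W) tscaleA tscale1 tscaleDr tscaleDl.

Lemma tpureZl c v w : tpure (c *: v) w = c *: tpure v w.
Proof. by rewrite [RHS]tscale_class. Qed.

Lemma tpureZr c v w : tpure v (c *: w) = c *: tpure v w.
Proof. by rewrite -tpureZl; apply/tclass_eq/tens_sym/tens_scale. Qed.

Lemma tpure0 w : tpure 0 w = 0.
Proof. by rewrite -(scale0r (0 : V)) tpureZl scale0r. Qed.

Lemma tens_ind (P : tens V W -> Prop) :
  P 0 -> (forall v w, P (tpure v w)) -> (forall t u, P t -> P u -> P (t + u)) ->
  forall t, P t.
Proof.
move=> P0 P1 PD; elim/tclassW; elim=> [//|p s IHs].
by rewrite tclass_cons; apply: PD.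
Qed.

End TensorModule.

(* The conditions under which f : V * W -> U factors through an additive map on
   V (x) W. K-bilinearity is not required, so that conjugate-linear maps such
   as the involution of A (x) A are covered. *)
Definition tens_balanced (K : comNzRingType) (V W : lmodType K) (U : nmodType)
    (f : V -> W -> U) : Prop :=
  [/\ forall v v' w, f (v + v') w = f v w + f v' w,
      forall v w w', f v (w + w') = f v w + f v w',
      forall c v w, f (c *: v) w = f v (c *: w)
    & forall w, f 0 w = 0].

(* The additive map on V (x) W induced by f. It is computed on a chosen
   representative, hence is meaningful only for balanced f: see tlift_pure
   and tliftD. *)
Definition tlift (K : comNzRingType) (V W : lmodType K) (U : nmodType)
    (f : V -> W -> U) (t : tens V W) : U :=
  \sum_(p <- repr t) f p.1 p.2.

Section TensorLift.
Context {K : comNzRingType} {V W : lmodType K} {U : nmodType}.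
Variables (f : V -> W -> U) (f_bal : tens_balanced f).

Lemma tlift_class s : tlift f (tclass s) = \sum_(p <- s) f p.1 p.2.
Proof.
case: f_bal => fDl fDr fZ f0; rewrite /tlift.
move: (repr _) (repr_tclass s) => r rs; elim: r s / rs => //.
- by move=> s t u _ -> _ ->.
- by move=> s s' t t' _ IHs _ IHt; rewrite !big_cat /= IHs IHt.
- by move=> s t; rewrite !big_cat /= addrC.
- by move=> v v' w; rewrite !big_cons !big_nil /= fDl !addr0.
- by move=> v w w'; rewrite !big_cons !big_nil /= fDr !addr0.
- by move=> c v w; rewrite !big_cons !big_nil /= fZ.
- by move=> w; rewrite !big_cons !big_nil /= f0 addr0.
Qed.

Lemma tlift_pure v w : tlift f (tpure v w) = f v w.
Proof. by rewrite tlift_class big_seq1. Qed.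

Lemma tlift0 : tlift f 0 = 0.
Proof. by rewrite -tclass0 tlift_class big_nil. Qed.

Lemma tliftD : {morph tlift f : t u / t + u}.
Proof.
move=> t u; rewrite -[t]tclassK -[u]tclassK.
by rewrite -tclass_cat !tlift_class big_cat.
Qed.

End TensorLift.

Definition tmap (K : comNzRingType) (V W V' W' : lmodType K)
    (f : V -> V') (g : W -> W') : tens V W -> tens V' W' :=
  tlift (fun v w => tpure (f v) (g w)).

Definition tassoc (K : comNzRingType) (V W X : lmodType K) :
    tens (tens V W) X -> tens V (tens W X) :=
  tlift (fun t x => tlift (fun v w => tpure v (tpure w x)) t).

(* A (x) B is only given a possibly trivial ring structure: 1 != 0 may fail
   over a general K. *)
Section TensorRing.
Context {K : comNzRingType} {A B : algType K}.
Implicit Types t u : tens A B.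

Definition tmul t u : tens A B :=
  tlift (fun a b => tlift (fun a' b' => tpure (a * a') (b * b')) u) t.
Definition tone : tens A B := tpure 1 1.

Let bal_r (a : A) (b : B) : tens_balanced (fun a' b' => tpure (a * a') (b * b')).
Proof.
split=> [v v' w|v w w'|c v w|w].
- by rewrite mulrDr tpureDl.
- by rewrite mulrDr tpureDr.
- by rewrite -!scalerAr tpureZl tpureZr.
- by rewrite mulr0 tpure0.
Qed.

Let bal_l u : tens_balanced (fun (a : A) (b : B) =>
  tlift (fun a' b' => tpure (a * a') (b * b')) u).
Proof.
split=> [v v' w|v w w'|c v w|w].
- elim/(@tens_ind K A B): u => [|x y|t u IHt IHu]; first by rewrite !tlift0 // addr0.
    by rewrite !tlift_pure // mulrDl tpureDl.
  by rewrite !tliftD // IHt IHu addrACA.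
- elim/(@tens_ind K A B): u => [|x y|t u IHt IHu]; first by rewrite !tlift0 // addr0.
    by rewrite !tlift_pure // mulrDl tpureDr.
  by rewrite !tliftD // IHt IHu addrACA.
- elim/(@tens_ind K A B): u => [|x y|t u IHt IHu]; first by rewrite !tlift0.
    by rewrite !tlift_pure // -!scalerAl tpureZl tpureZr.
  by rewrite !tliftD // IHt IHu.
- elim/(@tens_ind K A B): u => [|x y|t u IHt IHu]; first by rewrite !tlift0.
    by rewrite !tlift_pure // mul0r tpure0.
  by rewrite !tliftD // IHt IHu addr0.
Qed.

Lemma tmul_pure a b a' b' :
  tmul (tpure a b) (tpure a' b') = tpure (a * a') (b * b').
Proof. by rewrite /tmul !tlift_pure. Qed.

Fact tmulDl : left_distributive tmul +%R.
Proof. by move=> t t' u; rewrite /tmul tliftD. Qed.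

Fact tmul0 : left_zero 0 tmul.
Proof. by move=> u; rewrite /tmul tlift0. Qed.

Fact tmulr0 : right_zero 0 tmul.
Proof.
elim/(@tens_ind K A B)=> [|a b|t u IHt IHu]; first by rewrite tmul0.
  by rewrite /tmul tlift_pure ?tlift0.
by rewrite tmulDl IHt IHu addr0.
Qed.

Fact tmulDr : right_distributive tmul +%R.
Proof.
move=> t u u'; elim/(@tens_ind K A B): t => [|a b|t t' IHt IHt'].
- by rewrite !tmul0 addr0.
- by rewrite /tmul !tlift_pure ?tliftD.
- by rewrite !tmulDl IHt IHt' addrACA.
Qed.

Fact tmulA : associative tmul.
Proof.
move=> t u v; elim/(@tens_ind K A B): t => [|a b|t t' IHt IHt'].
- by rewrite !tmul0.
- elim/(@tens_ind K A B): u => [|a' b'|u u' IHu IHu'].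
  + by rewrite !tmul0 !tmulr0 !tmul0.
  + elim/(@tens_ind K A B): v => [|a'' b''|v v' IHv IHv']; first by rewrite !tmulr0.
      by rewrite !tmul_pure !mulrA.
    by rewrite !tmulDr IHv IHv'.
  + by rewrite !(tmulDl, tmulDr) IHu IHu'.
- by rewrite !tmulDl IHt IHt'.
Qed.

Fact tmul1 : left_id tone tmul.
Proof.
elim/(@tens_ind K A B)=> [|a b|t u IHt IHu]; first exact: tmulr0.
  by rewrite tmul_pure !mul1r.
by rewrite tmulDr IHt IHu.
Qed.

Fact tmulr1 : right_id tone tmul.
Proof.
elim/(@tens_ind K A B)=> [|a b|t u IHt IHu]; first exact: tmul0.
  by rewrite tmul_pure !mulr1.
by rewrite tmulDl IHt IHu.
Qed.

HB.instance Definition _ := GRing.Zmodule_isPzRing.Build (tens A B)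
  tmulA tmul1 tmulr1 tmulDl tmulDr.

Lemma tpureM (a a' : A) (b b' : B) :
  tpure a b * tpure a' b' = tpure (a * a') (b * b').
Proof. exact: tmul_pure. Qed.

End TensorRing.

Section VectorSpaces.
Context {R : realType} {V : lmodType R[i]}.

Definition conj_linear (W : lmodType R[i]) (f : V -> W) : Prop :=
  forall (c : R[i]) u v, f (c *: u + v) = c^* *: f u + f v.

Definition is_subspace (U : set V) : Prop :=
  U 0 /\ forall (c : R[i]) u v, U u -> U v -> U (c *: u + v).

Definition lin_span (S : set V) : set V :=
  [set v | exists n (c : 'I_n -> R[i]) (x : 'I_n -> V),
    (forall i, S (x i)) /\ v = \sum_i c i *: x i].

Definition has_dim (U : set V) (n : nat) : Prop :=
  exists b : 'I_n -> V,
    (forall c : 'I_n -> R[i], \sum_i c i *: b i = 0 -> forall i, c i = 0)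
    /\ U = lin_span (range b).

Definition inner_product_on (U : set V) (ip : V -> V -> R[i]) : Prop :=
  [/\ forall c u v w, U u -> U v -> U w ->
        ip (c *: u + v) w = c * ip u w + ip v w,
      forall u v, U u -> U v -> ip v u = (ip u v)^*
    & forall u, U u -> u != 0 -> 0 < ip u u].

End VectorSpaces.

Record hopf_star_algebra (R : realType) (A : algType R[i]) := HopfStarAlgebra {
  comul : {lrmorphism A -> tens A A | *:%R};
  counit : {lrmorphism A -> R[i] | *%R};
  antipode : {linear A -> A};
  hstar : A -> A;
  comulA : forall a,
    tassoc (tmap comul idfun (comul a)) = tmap idfun comul (comul a);
  counitl : forall a, tlift (fun x y => counit x *: y) (comul a) = a;
  counitr : forall a, tlift (fun x y => counit y *: x) (comul a) = a;
  antipodel : forall a,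
    tlift (fun x y => antipode x * y) (comul a) = (counit a)%:A;
  antipoder : forall a,
    tlift (fun x y => x * antipode y) (comul a) = (counit a)%:A;
  hstar_conj_linear : conj_linear hstar;
  hstarK : involutive hstar;
  hstarM : forall a b, hstar (a * b) = hstar b * hstar a;
  comul_star : forall a, comul (hstar a) = tmap hstar hstar (comul a) }.

Record haar_integral (R : realType) (A : algType R[i])
    (H : hopf_star_algebra A) (h : {scalar A}) : Prop := HaarIntegral {
  haar1 : h 1 = 1;
  haar_ge0 : forall a, 0 <= h (hstar H a * a);
  haar_invl : forall a, tlift (fun x y => h y *: x) (comul H a) = (h a)%:A;
  haar_invr : forall a, tlift (fun x y => h x *: y) (comul H a) = (h a)%:A }.

Record graded_star_algebra (R : realType) (Omega : algType R[i]) :=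
    GradedStarAlgebra {
  gr : nat -> set Omega;
  gr_subspace : forall n, is_subspace (gr n);
  gr_sum : forall w, exists n (f : nat -> Omega),
    (forall k, gr k (f k)) /\ w = \sum_(k < n) f k;
  gr_direct : forall n (f : nat -> Omega), (forall k, gr k (f k)) ->
    \sum_(k < n) f k = 0 -> forall k, (k < n)%N -> f k = 0;
  grM : forall m n w w', gr m w -> gr n w' -> gr (m + n)%N (w * w');
  gstar : Omega -> Omega;
  gstar_conj_linear : conj_linear gstar;
  gstar_gr : forall n w, gr n w -> gr n (gstar w);
  gstarK : involutive gstar;
  gstarM : forall k l w w', gr k w -> gr l w' ->
    gstar (w * w') = (- 1) ^+ (k * l) *: (gstar w' * gstar w) }.

Record graded_star_diff_algebra (R : realType) (Omega : algType R[i]) :=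
    GradedStarDiffAlgebra {
  gsda_graded :> graded_star_algebra Omega;
  extd : {linear Omega -> Omega};
  extd_gr : forall n w, gr gsda_graded n w -> gr gsda_graded n.+1 (extd w);
  extd_extd : forall w, extd (extd w) = 0;
  extd_star : forall w, extd (gstar gsda_graded w) = gstar gsda_graded (extd w);
  extdM : forall k w' w, gr gsda_graded k w' ->
    extd (w' * w) = extd w' * w + (- 1) ^+ k *: (w' * extd w) }.

(* The identification of A with the degree 0 part of Omega is the injective
   morphism incl. *)
Record star_diff_calculus (R : realType) (A : algType R[i])
    (H : hopf_star_algebra A) (Omega : algType R[i]) := StarDiffCalculus {
  calc_gsda :> graded_star_diff_algebra Omega;
  incl : {lrmorphism A -> Omega};
  incl_inj : injective incl;
  incl_gr0 : gr calc_gsda 0 = range incl;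
  incl_star : forall a, gstar calc_gsda (incl a) = incl (hstar H a);
  gr_span : forall k, (0 < k)%N ->
    gr calc_gsda k =
    lin_span [set w | exists (a0 : A) (a : 'I_k -> A),
                w = incl a0 * \prod_(i < k) extd calc_gsda (incl (a i))];
  coact : {lrmorphism Omega -> tens A Omega | *:%R};
  coact_incl : forall a, coact (incl a) = tmap idfun incl (comul H a);
  coact_extd : forall w,
    tmap idfun (extd calc_gsda) (coact w) = coact (extd calc_gsda w);
  extd1 : extd calc_gsda 1 = 0 }.

Section Calculus.
Context {R : realType} {A : algType R[i]} {H : hopf_star_algebra A}.
Context {Omega : algType R[i]} (calc : star_diff_calculus H Omega).
Local Notation incl := (incl calc).

Definition inv_form : set Omega := [set w | coact calc w = tpure 1 w].

Definition inv_gr (k : nat) : set Omega := gr calc k `&` inv_form.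

Definition strongly_finite_dim : Prop := exists n, has_dim inv_form n.

Definition calc_dim (N : nat) : Prop :=
  (exists2 w, gr calc N w & w != 0)
  /\ forall k w, (N < k)%N -> gr calc k w -> w = 0.

Definition non_degenerate (N : nat) : Prop :=
  forall k w, (k <= N)%N -> gr calc k w ->
    (forall w', gr calc (N - k) w' -> w' * w = 0) -> w = 0.

Definition graded_inner_product_on (U : set Omega)
    (ip : Omega -> Omega -> R[i]) : Prop :=
  inner_product_on U ip
  /\ forall k l w w', k <> l -> (gr calc k `&` U) w -> (gr calc l `&` U) w' ->
       ip w w' = 0.

(* ip is an inner product on invariant forms, ipO one on all of Omega. *)
Definition induced_inner_product (h : {scalar A})
    (ip ipO : Omega -> Omega -> R[i]) : Prop :=
  inner_product_on setT ipO
  /\ forall a b w w', inv_form w -> inv_form w' ->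
       ipO (incl a * w) (incl b * w') = h (hstar H b * a) * ip w w'.

Definition volume_element (N : nat) (ip : Omega -> Omega -> R[i])
    (theta : Omega) : Prop :=
  [/\ inv_gr N theta, ip theta theta = 1 & gstar calc theta = theta].

Definition is_integral (h : {scalar A}) (N : nat) (theta : Omega)
    (integ : {scalar Omega}) : Prop :=
  (forall k w, (k < N)%N -> gr calc k w -> integ w = 0)
  /\ forall a, integ (incl a * theta) = h a.

Definition hodge_operator (N : nat) (ipO : Omega -> Omega -> R[i])
    (integ : {scalar Omega}) (L : {linear Omega -> Omega}) : Prop :=
  [/\ forall a w, L (incl a * w) = incl a * L w,
      forall k, (k <= N)%N -> L @` gr calc k = gr calc (N - k)
    & forall w w', integ (gstar calc w * L w') = ipO w' w].

End Calculus.

Definition ip_adjoint (R : realType) (V : lmodType R[i]) (ip : V -> V -> R[i])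
    (f g : V -> V) : Prop :=
  forall u v, ip (f u) v = ip u (g v).

Definition ip_unitary (R : realType) (V : lmodType R[i]) (ip : V -> V -> R[i])
    (f : V -> V) : Prop :=
  bijective f /\ forall u v, ip (f u) (f v) = ip u v.

Definition laplacian (V : zmodType) (d dstar : V -> V) (w : V) : V :=
  let D x := d x + dstar x in D (D w).

(* Main.v *)
(* Write [V] for the space of left-invariant forms. The map
   [w |-> S(w_(-1)) w_(0)] projects [Omega] onto [V] and yields the
   factorisation [Omega = A (x) V], so that everything reduces to a homogeneous
   basis [e_i] of [V]. The matrix [M_ij = int (e_i)^* e_j] is invertible by
   non-degeneracy and, after multiplication of its rows by square roots [s_i]
   of [(-1)^(k(N-k))], becomes a hermitian matrix [H = J |H|]. Taking [|H|] as
   the Gram matrix of the inner product turns the Hodge operator, which is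
   determined by [M L = |H|], into [L = s J]; since [J] is a hermitian
   involution commuting with [s] and [|H|], [L] is unitary and squares to
   [(-1)^(k(N-k))]. As [h] is left invariant and [d] kills [V_(N-1)], exact
   forms integrate to [0], and Stokes' formula shows that the adjoint of [d] is
   [L d L] up to sign, from which the remaining identities follow. *)

From HB Require Import structures.
Require Import Defs.
From mathcomp Require Import all_boot all_order all_algebra.
From mathcomp Require Import boolp classical_sets reals.
From mathcomp Require Import ring.

Import Order.TTheory GRing.Theory Num.Theory.
Local Open Scope ring_scope.

Set Implicit Arguments.
Unset Strict Implicit.
Unset Printing Implicit Defensive.

(** * Linear maps out of tensor products *)

(** The square roots are dictated by the graded involution: M_ij is nonzero only if the degrees of
    e_i and e_j add up to N, and then the conjugate of M_ij is (-1)^(k(N-k)) M_ji, with k the degree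
    of e_i. Any Gram matrix G yields a Hodge operator M^-1 G; for a graded G, unitarity amounts to G
    H^-1 G = H, which |H| satisfies. The volume element is delicate: theta normalises the integral
    from which the inner product is built, and must then be a unit vector for that product. The
    basis is therefore made to contain 1 and theta. They span the invariant forms of degrees 0 and N
    and H exchanges them, so H^2, and with it |H|, fixes theta. In the same way H^2 preserves
    degrees, hence |H| does, and the inner product is graded. The theorem concerns every volume
    element of the inner product found. Another one is c theta with c real and c^2 = 1; it replaces
    L by c L and leaves the codifferential, quadratic in L, unchanged. *)

Definition bilin (K : comNzRingType) (V W U : lmodType K) (f : V -> W -> U) :=
  (forall w, linear (f^~ w)) /\ (forall v, linear (f v)).

(** Bundling a proved linearity gives Sweedler expressions access to the theory of linear maps. *)
Lemma linear_pack (K : nzRingType) (V W : lmodType K) (f : V -> W) :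
  linear f -> exists g : {linear V -> W}, g =1 f.
Proof.
move=> f_lin; pose m := GRing.isLinear.Build _ _ _ _ f f_lin.
pose g : {linear V -> W} := HB.pack f m; by exists g.
Qed.

Lemma scalar_pack (K : nzRingType) (V : lmodType K) (f : V -> K) :
  scalar f -> exists g : {scalar V}, g =1 f.
Proof.
move=> f_lin; pose m := GRing.isLinear.Build _ _ _ _ f f_lin.
pose g : {scalar V} := HB.pack f m; by exists g.
Qed.

Lemma linear_on0 (K : nzRingType) (V W : lmodType K) (f : V -> W) :
  linear f -> f 0 = 0.
Proof. by case/linear_pack => g gf; rewrite -gf linear0. Qed.

Lemma linear_onD (K : nzRingType) (V W : lmodType K) (f : V -> W) :
  linear f -> {morph f : x y / x + y}.
Proof. by case/linear_pack => g gf x y; rewrite -!gf linearD. Qed.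

Lemma linear_onZ (K : nzRingType) (V W : lmodType K) (f : V -> W) :
  linear f -> forall c, {morph f : x / c *: x}.
Proof. by case/linear_pack => g gf c x; rewrite -!gf linearZ. Qed.

Section LinearComposition.
Context {K : comNzRingType} {V W : lmodType K}.

Lemma lin_id : linear (fun x : V => x). Proof. by []. Qed.

Lemma lin_app (X : lmodType K) (g : {linear W -> X}) (f : V -> W) :
  linear f -> linear (fun x => g (f x)).
Proof. by move=> fl c x y; rewrite fl linearP. Qed.

Lemma lin_comp (X : lmodType K) (g : W -> X) (f : V -> W) :
  linear g -> linear f -> linear (fun x => g (f x)).
Proof. by move=> gl fl c x y; rewrite fl gl. Qed.

Lemma scal_app (g : {scalar W}) (f : V -> W) :
  linear f -> scalar (fun x => g (f x)).
Proof. by move=> fl c x y; rewrite fl linearP. Qed.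

Lemma lin_scalel (f : V -> K) (w : W) : scalar f -> linear (fun x => f x *: w).
Proof. by move=> fl c x y; rewrite fl scalerDl scalerA. Qed.

Lemma lin_scaler (f : V -> W) (a : K) : linear f -> linear (fun x => a *: f x).
Proof. by move=> fl c x y; rewrite fl scalerDr !scalerA mulrC. Qed.

Lemma lin_mull (B : algType K) (f : V -> B) (b : B) :
  linear f -> linear (fun x => f x * b).
Proof. by move=> fl c x y; rewrite fl mulrDl scalerAl. Qed.

Lemma lin_mulr (B : algType K) (f : V -> B) (b : B) :
  linear f -> linear (fun x => b * f x).
Proof. by move=> fl c x y; rewrite fl mulrDr scalerAr. Qed.

(** [tens A B] is used as a ring and as a module, so the compatibility of scaling with the product
    is checked on pure tensors. *)
Lemma lin_tmull (A B : algType K) (f : V -> tens A B) (t : tens A B) :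
  linear f -> linear (fun x => f x * t).
Proof.
move=> fl c x y; rewrite fl mulrDl; congr (_ + _).
elim/(@tens_ind K A B): (f x) => [|a b|u v IHu IHv].
- by rewrite scaler0 !mul0r scaler0.
- elim/(@tens_ind K A B): t => [|a' b'|u v IHu IHv]; first by rewrite !mulr0 scaler0.
    by rewrite -tpureZl !tpureM -scalerAl tpureZl.
  by rewrite !mulrDr IHu IHv scalerDr.
- by rewrite scalerDr !mulrDl scalerDr IHu IHv.
Qed.

Lemma lin_tmulr (A B : algType K) (f : V -> tens A B) (t : tens A B) :
  linear f -> linear (fun x => t * f x).
Proof.
move=> fl c x y; rewrite fl mulrDr; congr (_ + _).
elim/(@tens_ind K A B): (f x) => [|a b|u v IHu IHv].
- by rewrite scaler0 !mulr0 scaler0.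
- elim/(@tens_ind K A B): t => [|a' b'|u v IHu IHv]; first by rewrite !mul0r scaler0.
    by rewrite -tpureZl !tpureM -scalerAr tpureZl.
  by rewrite !mulrDl IHu IHv scalerDr.
- by rewrite scalerDr !mulrDr scalerDr IHu IHv.
Qed.

Lemma lin_tpurel (X : lmodType K) (f : V -> W) (x : X) :
  linear f -> linear (fun v => tpure (f v) x).
Proof. by move=> fl c v v'; rewrite fl tpureDl tpureZl. Qed.

Lemma lin_tpurer (X : lmodType K) (f : V -> W) (x : X) :
  linear f -> linear (fun v => tpure x (f v)).
Proof. by move=> fl c v v'; rewrite fl tpureDr tpureZr. Qed.

End LinearComposition.

Section TensorLift.
Context {K : comNzRingType}.
Implicit Types (V W U X : lmodType K).

Lemma bilin_balanced V W U (f : V -> W -> U) : bilin f -> tens_balanced f.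
Proof.
case=> fl fr; split=> [v v' w|v w w'|c v w|w].
- exact: (linear_onD (fl w)).
- exact: (linear_onD (fr v)).
- by rewrite (linear_onZ (fl w)) (linear_onZ (fr v)).
- exact: (linear_on0 (fl w)).
Qed.

Lemma tens_eq_lin V W U (f g : tens V W -> U) : linear f -> linear g ->
  (forall v w, f (tpure v w) = g (tpure v w)) -> f =1 g.
Proof.
move=> fl gl fg; elim/(@tens_ind K V W) => [|//|t u IHt IHu].
  by rewrite !linear_on0.
by rewrite !linear_onD // IHt IHu.
Qed.

Lemma tlift_lin V W U (f : V -> W -> U) : bilin f -> linear (tlift f).
Proof.
move=> f_bil; have f_bal := bilin_balanced f_bil.
move=> c t u; rewrite tliftD //; congr (_ + _).
elim/(@tens_ind K V W): t => [|v w|t t' IHt IHt'].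
- by rewrite scaler0 tlift0 ?scaler0.
- by rewrite -tpureZl !tlift_pure // (linear_onZ (f_bil.1 w)).
- by rewrite scalerDr !tliftD // IHt IHt' scalerDr.
Qed.

Lemma eq_tlift V W (U : nmodType) (f g : V -> W -> U) :
  (forall v w, f v w = g v w) -> tlift f =1 tlift g.
Proof. by move=> fg t; apply: eq_bigr => p _. Qed.

Lemma tpure_bilin V W : bilin (@tpure K V W).
Proof.
split=> [w|v] c x y; first by rewrite tpureDl tpureZl.
by rewrite tpureDr tpureZr.
Qed.

Lemma tlift_tpure V W (t : tens V W) : tlift (@tpure K V W) t = t.
Proof.
have b := tpure_bilin V W.
apply: (@tens_eq_lin _ _ _ _ id); [exact: tlift_lin| by []|].
by move=> v w; rewrite tlift_pure //; apply: bilin_balanced.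
Qed.

Lemma lin_tlift V W U X (g : U -> X) (f : V -> W -> U) (t : tens V W) :
  linear g -> g (tlift f t) = tlift (fun v w => g (f v w)) t.
Proof.
move=> /linear_pack[g' g'E]; rewrite -g'E /tlift linear_sum.
by apply: eq_bigr => p _; rewrite g'E.
Qed.

Lemma tlift_param_lin X V W U (f : X -> V -> W -> U) (t : tens V W) :
  (forall v w, linear (fun x => f x v w)) -> linear (fun x => tlift (f x) t).
Proof.
move=> fl c x y; rewrite /tlift scaler_sumr -big_split /=.
by apply: eq_bigr => p _; rewrite fl.
Qed.

Lemma lin_tlift_app X V W U (F : V -> W -> U) (f : X -> tens V W) :
  bilin F -> linear f -> linear (fun x => tlift F (f x)).
Proof. by move=> Fb fl c x y; rewrite fl tlift_lin. Qed.

Lemma tmap_lin V W V' W' (f : {linear V -> V'}) (g : {linear W -> W'}) :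
  linear (tmap f g).
Proof.
apply: tlift_lin; split=> [w|v] c x y; rewrite linearP.
  by rewrite tpureDl tpureZl.
by rewrite tpureDr tpureZr.
Qed.

Lemma tlift_tmap V W V' W' U (f : {linear V -> V'}) (g : {linear W -> W'})
  (F : V' -> W' -> U) t : bilin F ->
  tlift F (tmap f g t) = tlift (fun v w => F (f v) (g w)) t.
Proof.
move=> F_bil; rewrite /tmap lin_tlift; last exact: tlift_lin.
by apply: eq_tlift => v w; rewrite tlift_pure //; apply: bilin_balanced.
Qed.

(** Coassociativity in Sweedler form: an equality in a threefold tensor product is used through a
    trilinear map [f]. Both sides are evaluated by the linear map [T] that [f] induces on
    [tens Y (tens W X)]. *)
Lemma tlift_assoc V W X U (Y Z : lmodType K) (f : Y -> W -> X -> U)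
    (D : {linear V -> tens Y W}) (E : {linear Z -> tens W X})
    (t : tens V X) (t' : tens Y Z) :
  (forall w x, linear (fun y => f y w x)) -> (forall y x, linear (fun w => f y w x)) ->
  (forall y w, linear (f y w)) ->
  tassoc (tmap D idfun t) = tmap idfun E t' ->
  tlift (fun v x => tlift (fun y w => f y w x) (D v)) t =
  tlift (fun y z => tlift (f y) (E z)) t'.
Proof.
move=> f1 f2 f3 tt'.
have fy y : bilin (f y) by split.
have fx x : bilin (fun y w => f y w x) by split=> [w|y]; [exact: f1|exact: f2].
pose T := tlift (fun y (s : tens W X) => tlift (f y) s).
have Tb : bilin (fun y (s : tens W X) => tlift (f y) s).
  by split=> [s|y]; [apply: tlift_param_lin|apply: tlift_lin].
have Tl : linear T by apply: tlift_lin.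
have := congr1 T tt'.
have -> : T (tmap idfun E t') = tlift (fun y z => tlift (f y) (E z)) t'.
  by rewrite /T tlift_tmap.
move=> <-.
have b1 : bilin (fun (t1 : tens Y W) (x : X) => tlift (fun y w => tpure y (tpure w x)) t1).
  split=> [x|t1].
    by apply: tlift_lin; split=> [w|y] c a b; rewrite ?(tpureDl, tpureDr, tpureZl, tpureZr).
  by apply: tlift_param_lin => y w c a b; rewrite !(tpureDr, tpureZr).
rewrite /tassoc (lin_tlift _ _ Tl).
rewrite (@tlift_tmap _ _ _ _ _ D idfun (fun t1 x => T (tlift (fun y w => tpure y (tpure w x)) t1))); last first.
  split=> [x|t1] c a b; first by rewrite (b1.1 x) Tl.
  by rewrite (b1.2 t1) Tl.
apply: eq_tlift => v x /=; rewrite (lin_tlift _ _ Tl).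
apply: eq_tlift => y w; rewrite /T tlift_pure; last exact: bilin_balanced.
by rewrite tlift_pure //; apply: bilin_balanced.
Qed.

End TensorLift.

Lemma tlift_mul (K : comNzRingType) (A B : algType K) (U : lmodType K)
    (f : A -> B -> U) (t u : tens A B) : bilin f ->
  tlift f (t * u) =
  tlift (fun a b => tlift (fun a' b' => f (a * a') (b * b')) u) t.
Proof.
move=> fb; rewrite (lin_tlift _ _ (tlift_lin fb)); apply: eq_tlift => a b.
rewrite (lin_tlift _ _ (tlift_lin fb)); apply: eq_tlift => a' b'.
by rewrite tlift_pure //; apply: bilin_balanced.
Qed.

Lemma mulr_tlift (K : comNzRingType) (V W : lmodType K) (B : algType K) (b : B)
    (f : V -> W -> B) (t : tens V W) :
  b * tlift f t = tlift (fun v w => b * f v w) t.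
Proof. by rewrite /tlift mulr_sumr. Qed.

Lemma tmull_tlift (K : comNzRingType) (V W : lmodType K) (A B : algType K)
    (x : tens A B) (f : V -> W -> tens A B) (t : tens V W) :
  tlift f t * x = tlift (fun v w => f v w * x) t.
Proof. by rewrite /tlift mulr_suml. Qed.

Lemma tmulr_tlift (K : comNzRingType) (V W : lmodType K) (A B : algType K)
    (x : tens A B) (f : V -> W -> tens A B) (t : tens V W) :
  x * tlift f t = tlift (fun v w => x * f v w) t.
Proof. by rewrite /tlift mulr_sumr. Qed.

(* A representation of minimal length has independent left factors. *)
Lemma tens_indep (K : fieldType) (V W : lmodType K) (t : tens V W) :
  exists n (v : 'I_n -> V) (w : 'I_n -> W), t = \sum_i tpure (v i) (w i) /\
    forall c : 'I_n -> K, \sum_i c i *: v i = 0 -> forall i, c i = 0.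
Proof.
have : exists n (v : 'I_n -> V) (w : 'I_n -> W), t = \sum_i tpure (v i) (w i).
  elim/(@tens_ind K V W): t => [|v w|t u [n [v [w ->]]] [m [v' [w' ->]]]].
  - by exists 0%N, (fun=> 0), (fun=> 0); rewrite big_ord0.
  - by exists 1%N, (fun=> v), (fun=> w); rewrite big_ord1.
  - exists (n + m)%N, (fun i => match split i with inl j => v j | inr j => v' j end),
      (fun i => match split i with inl j => w j | inr j => w' j end).
    rewrite big_split_ord; congr (_ + _); apply: eq_bigr => i _.
      by rewrite (unsplitK (inl i)).
    by rewrite (unsplitK (inr i)).
case=> n; elim: n => [|n IHn] [v [w tE]].
  by exists 0%N, v, w; split=> // c _ [].
have [ind|dep] := pselect (forall c : 'I_n.+1 -> K, \sum_i c i *: v i = 0 -> forall i, c i = 0).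
  by exists n.+1, v, w.
move/existsNP: dep => [c /not_implyP[c0 /existsNP[j /eqP cj]]].
(* Solving the relation for [v j] eliminates the j-th term; its right factor [w j] is spread over
   the remaining ones. *)
apply: IHn; exists (fun i => v (lift j i)), (fun i => w (lift j i) - (c (lift j i) / c j) *: w j).
have vj : v j = - \sum_(i < n) (c (lift j i) / c j) *: v (lift j i).
  apply: (scalerI cj); rewrite scalerN scaler_sumr.
  move: c0; rewrite (bigD1_ord j) //= => /eqP; rewrite addr_eq0 => /eqP ->.
  congr (- _); apply: eq_bigr => i _.
  by rewrite scalerA mulrCA divff // mulr1.
rewrite tE (bigD1_ord j) //= addrC {1}vj.
have [T TE] := linear_pack ((tpure_bilin V W).1 (w j)).
rewrite -TE linearN linear_sum -sumrN -big_split /=; apply: eq_bigr => i _.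
have [T' T'E] := linear_pack ((tpure_bilin V W).2 (v (lift j i))).
by rewrite TE tpureZl -!T'E linearB [X in _ = _ - X]linearZ.
Qed.

(** Proves linearity by recursion on the shape of the term; most Sweedler computations below have
    side conditions of this kind. *)
Ltac lin :=
  lazymatch goal with
  | |- bilin _ => split=> ?; lin
  | |- forall _, _ => intro; lin
  | |- _ => first [ exact: lin_id | exact: linearP
     | match goal with f_lin : _ |- _ => exact: f_lin end
     | match goal with f_bil : bilin _ |- _ => first [exact: (f_bil.1 _) | exact: (f_bil.2 _)] end
     | apply: tlift_param_lin => ? ?; lin
     | apply: lin_tlift_app; lin
     | apply: lin_tpurel; lin | apply: lin_tpurer; lin
     | apply: lin_tmull; lin | apply: lin_tmulr; lin
     | apply: lin_mull; lin | apply: lin_mulr; lin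
     | apply: lin_scalel; lin | apply: lin_scaler; lin
     | apply: scal_app; lin | apply: lin_app; lin
     | match goal with f_lin : _ |- _ =>
         first [ apply: (lin_comp (f_lin _)) | apply: (lin_comp (f_lin _ _))
               | apply: (lin_comp (f_lin.1 _)) | apply: (lin_comp (f_lin.2 _)) ]; lin
       end ]
  end.

Lemma tlift_exchange (K : comNzRingType) (V W V' W' U : lmodType K)
    (f : V -> W -> V' -> W' -> U) (t : tens V W) (t' : tens V' W') :
  tlift (fun v w => tlift (f v w) t') t =
  tlift (fun v' w' => tlift (fun v w => f v w v' w') t) t'.
Proof. exact: exchange_big. Qed.

(* The image of [V (x) U] in [V (x) W]. *)
Inductive tens_in (K : comNzRingType) (V W : lmodType K) (U : set W) :
    tens V W -> Prop :=
| tens_in0 : tens_in U 0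
| tens_in_pure v w : U w -> tens_in U (tpure v w)
| tens_inD t u : tens_in U t -> tens_in U u -> tens_in U (t + u).

Lemma tens_inZ (K : comNzRingType) (V W : lmodType K) (U : set W) c (t : tens V W) :
  tens_in U t -> tens_in U (c *: t).
Proof.
elim=> [|v w Uw|t' u _ IHt _ IHu].
- by rewrite scaler0; apply: tens_in0.
- by rewrite -tpureZl; apply: tens_in_pure.
- by rewrite scalerDr; apply: tens_inD.
Qed.

(** * Subspaces, tensors with right factors in a subspace, conjugate-linear maps *)

Section Subspace.
Context {R : realType} {V : lmodType R[i]} (U : set V).
Hypothesis Usub : is_subspace U.

Lemma subspace0 : U 0. Proof. exact: Usub.1. Qed.

Lemma subspaceD u v : U u -> U v -> U (u + v).
Proof. by move=> Uu Uv; rewrite -[u]scale1r; apply: Usub.2. Qed.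

Lemma subspaceZ c u : U u -> U (c *: u).
Proof. by move=> Uu; rewrite -[_ *: _]addr0; apply: Usub.2 => //; apply: subspace0. Qed.

Lemma subspace_sum I (r : seq I) (P : pred I) (F : I -> V) :
  (forall i, P i -> U (F i)) -> U (\sum_(i <- r | P i) F i).
Proof. by move=> UF; apply: big_ind => //; [exact: subspace0|exact: subspaceD]. Qed.

End Subspace.

Lemma tens_inT (K : comNzRingType) (V W : lmodType K) (t : tens V W) :
  tens_in setT t.
Proof.
elim/(@tens_ind K V W): t => [|v w|t u IHt IHu]; first exact: tens_in0.
  exact: tens_in_pure.
exact: tens_inD.
Qed.

Lemma tens_in_mul (K : comNzRingType) (A B : algType K) (U U' U'' : set B)
    (t u : tens A B) : (forall x y, U x -> U' y -> U'' (x * y)) ->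
  tens_in U t -> tens_in U' u -> tens_in U'' (t * u).
Proof.
move=> UU tU uU'; elim: tU => [|v w Uw|t1 t2 _ IH1 _ IH2].
- by rewrite mul0r; apply: tens_in0.
- elim: uU' => [|v' w' Uw'|u1 u2 _ IH1 _ IH2].
  + by rewrite mulr0; apply: tens_in0.
  + by rewrite tpureM; apply/tens_in_pure/UU.
  + by rewrite mulrDr; apply: tens_inD.
- by rewrite mulrDl; apply: tens_inD.
Qed.

Lemma tens_in_map (K : comNzRingType) (V W W' : lmodType K) (g : {linear W -> W'})
    (U : set W) (U' : set W') (t : tens V W) : (forall w, U w -> U' (g w)) ->
  tens_in U t -> tens_in U' (tmap idfun g t).
Proof.
move=> UU'; have tl := tmap_lin (idfun : {linear V -> V}) g.
elim=> [|v w Uw|t1 t2 _ IH1 _ IH2].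
- by rewrite (linear_on0 tl); apply: tens_in0.
- rewrite /tmap tlift_pure; first exact/tens_in_pure/UU'.
  by apply: bilin_balanced; lin.
- by rewrite (linear_onD tl); apply: tens_inD.
Qed.

Section ConjLinear.
Context {R : realType} {V W : lmodType R[i]} (f : V -> W).
Hypothesis f_lin : conj_linear f.

Lemma conj_linearD : {morph f : u v / u + v}.
Proof. by move=> u v; rewrite -{1}[u]scale1r f_lin conjC1 scale1r. Qed.

Lemma conj_linear0 : f 0 = 0.
Proof. by apply: (addrI (f 0)); rewrite -conj_linearD !addr0. Qed.

Lemma conj_linearZ c u : f (c *: u) = c^* *: f u.
Proof. by rewrite -[c *: u]addr0 f_lin conj_linear0 addr0. Qed.

Lemma conj_linear_sum I (r : seq I) (P : pred I) (F : I -> V) :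
  f (\sum_(i <- r | P i) F i) = \sum_(i <- r | P i) f (F i).
Proof. exact: (big_morph f conj_linearD conj_linear0). Qed.

End ConjLinear.

Lemma conj_tens_balanced (R : realType) (V V' W W' : lmodType R[i])
    (f : V -> V') (g : W -> W') : conj_linear f -> conj_linear g ->
  tens_balanced (fun v w => tpure (f v) (g w)).
Proof.
move=> fl gl; split=> [v v' w|v w w'|c v w|w].
- by rewrite conj_linearD // tpureDl.
- by rewrite conj_linearD // tpureDr.
- by rewrite (conj_linearZ fl) (conj_linearZ gl) tpureZl tpureZr.
- by rewrite conj_linear0 // tpure0.
Qed.

(** * Hermitian matrices *)

Section HermitianMatrix.
Local Open Scope sesquilinear_scope.

(* [E^* E] is [|H|] and [J] is the sign of [H]. *)
Lemma hermitian_polar (C : numClosedFieldType) n (H : 'M[C]_n) :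
  H^t* = H -> H \in unitmx ->
  exists E J : 'M[C]_n, let G := E^t* *m E in
  [/\ E \in unitmx, J *m J = 1%:M, J^t* = J, J *m H = G &
   [/\ H *m J = G,
       forall X : 'M[C]_n, X *m (H *m H) = H *m H *m X -> X *m G = G *m X &
       forall v : 'cV[C]_n, H *m H *m v = v -> G *m v = v]].
Proof.
move=> Hh Hu.
have Hs : H \is hermsymmx.
  by apply/is_hermitianmxP; rewrite expr0 scale1r Hh.
have /hermitian_normalmx /orthomx_spectralP HE := Hs.
have dreal := hermitian_spectral_diag_real Hs.
have Uu := spectral_unit H; have UV := invmx_unitary (spectral_unitarymx H).
move: HE dreal Uu UV; set U := spectralmx H; set d := spectral_diag H => HE dreal Uu UV.
have dr i : d 0 i \is Num.real by exact: (mxOverP dreal).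
have conjU (D D' : 'rV[C]_n) : invmx U *m diag_mx D *m U *m (invmx U *m diag_mx D' *m U)
    = invmx U *m diag_mx (\row_i (D 0 i * D' 0 i)) *m U.
  by rewrite -!mulmxA mulKVmx // [diag_mx D *m _]mulmxA mulmx_diag.
have d0 i : d 0 i != 0.
  have : diag_mx d \in unitmx.
    by move: Hu; rewrite {1}HE !unitmx_mul => /andP[/andP[_ ->]].
  by rewrite unitmxE det_diag unitfE => /prodf_neq0/(_ i isT).
have tC (D : 'rV[C]_n) : (forall i, D 0 i \is Num.real) ->
    (invmx U *m diag_mx D *m U)^t* = invmx U *m diag_mx D *m U.
  move=> Dr; rewrite UV !trmx_mul !map_mxM !trmxCK tr_diag_mx map_diag_mx mulmxA.
  congr (_ *m diag_mx _ *m _); apply/rowP => i; rewrite mxE; exact/CrealP.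
pose a : 'rV[C]_n := \row_i `|d 0 i|.
(* The inverse of the unitary U is its adjoint, so the square root of |D| splits |H| into an adjoint
   and its factor. *)
have GE : invmx U *m diag_mx a *m U =
    (diag_mx (\row_i sqrtC `|d 0 i|) *m U)^t* *m (diag_mx (\row_i sqrtC `|d 0 i|) *m U).
  rewrite trmx_mul map_mxM -UV tr_diag_mx map_diag_mx mulmxA -[in RHS](mulmxA (invmx U)) mulmx_diag.
  congr (_ *m diag_mx _ *m _); apply/rowP => i; rewrite !mxE.
  have /CrealP/= -> : sqrtC `|d 0 i| \is Num.real by rewrite ger0_real ?sqrtC_ge0.
  by rewrite -expr2 sqrtCK.
exists (diag_mx (\row_i sqrtC `|d 0 i|) *m U).
exists (invmx U *m diag_mx (\row_i (d 0 i / `|d 0 i|)) *m U) => /=.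
rewrite -GE; have dd i : d 0 i * d 0 i = `|d 0 i| * `|d 0 i|.
  by rewrite -!expr2 real_normK.
have n0 i : `|d 0 i| != 0 by rewrite normr_eq0.
split.
- rewrite unitmx_mul Uu andbT unitmxE det_diag unitfE.
  by apply/prodf_neq0 => i _; rewrite mxE sqrtC_eq0.
- rewrite conjU; set D := \row_i _; have -> : D = const_mx 1.
    by apply/rowP => i; rewrite !mxE mulrACA dd mulrACA divff // mulr1.
  by rewrite diag_const_mx mulmx1 mulVmx.
- by apply: tC => i; rewrite mxE rpred_div ?normr_real.
- rewrite [X in _ *m X = _]HE conjU; congr (_ *m diag_mx _ *m _); apply/rowP => i; rewrite !mxE.
  by rewrite mulrAC dd mulfK.
split.
- rewrite [X in X *m _ = _]HE conjU; congr (_ *m diag_mx _ *m _); apply/rowP => i; rewrite !mxE.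
  by rewrite mulrA dd mulfK.
(* In the eigenbasis, commuting with H^2 says that an entry y of [X] is zero unless d_i^2 = d_j^2;
   the absolute values then agree as well. *)
- move=> X; have -> : H *m H = invmx U *m diag_mx (\row_i (d 0 i * d 0 i)) *m U.
    by rewrite HE conjU.
  have [Y XE] : exists Y, X = invmx U *m Y *m U.
    by exists (U *m X *m invmx U); rewrite !mulmxA mulVmx // mul1mx mulmxKV.
  have conj2 A B : invmx U *m A *m U *m (invmx U *m B *m U) = invmx U *m (A *m B) *m U.
    by rewrite -!mulmxA mulKVmx.
  rewrite XE !conj2 => /(can_inj (mulmxK Uu))/(can_inj (mulKVmx Uu)) YD.
  congr (_ *m _ *m _); apply/matrixP => i j.
  move/matrixP/(_ i j): YD; rewrite !mul_mx_diag !mul_diag_mx !mxE; set y := Y i j.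
  have [->|y0] := eqVneq y 0; first by rewrite !mulr0 !mul0r.
  rewrite ![y * _]mulrC => /(mulIf y0); rewrite !dd -!expr2 => /eqP.
  by rewrite eqrXn2 // => /eqP ->.
(* An eigencoordinate of a vector fixed by H^2 vanishes unless d_i^2 = 1, that is |d_i| = 1. *)
- move=> v; have -> : H *m H = invmx U *m diag_mx (\row_i (d 0 i * d 0 i)) *m U.
    by rewrite HE conjU.
  rewrite -!mulmxA => /(congr1 (mulmx U)); rewrite mulKVmx // => Dv.
  apply: (can_inj (mulKmx Uu)); rewrite mulKVmx //.
  move: (U *m v) Dv => w Dw; apply/colP => i; move/colP/(_ i): Dw.
  rewrite !mul_diag_mx !mxE; set y := w i 0.
  have [->|y0] := eqVneq y 0; first by rewrite !mulr0.
  rewrite -{2}[y]mul1r => /(mulIf y0); rewrite dd -expr2 => /eqP.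
  by rewrite -[X in _ == X](expr1n _ 2) eqrXn2 // => /eqP ->; rewrite mul1r.
Qed.

(** The part of the theorem that lives on the invariant forms. H exchanges degrees k and N - k, so
    H^2 and G preserve degree while J = G H^-1 exchanges again. The hypotheses on the columns [i0]
    and [iT] serve the last conclusion, which makes the volume element a unit vector. *)
Lemma hodge_matrix (C : numClosedFieldType) n (dg : 'I_n -> nat) (N : nat)
    (M : 'M[C]_n) (i0 iT : 'I_n) :
  (forall i, dg i <= N)%N ->
  (forall i j, (dg i + dg j)%N != N -> M i j = 0) ->
  (forall i j, (M i j)^* = (- 1) ^+ (dg i * dg j) * M j i) ->
  M \in unitmx -> dg i0 = 0%N -> dg iT = N ->
  (forall i, M i iT = (i == i0)%:R) -> (forall i, M i i0 = (i == iT)%:R) ->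
  exists E L : 'M[C]_n, let G := E^t* *m E in
  [/\ E \in unitmx, M *m L = G, L^t* *m G *m L = G,
      forall i j, (L *m L) i j = (i == j)%:R * (- 1) ^+ (dg i * (N - dg i)) &
   [/\ forall i j, dg i != dg j -> G i j = 0,
       forall i j, (dg i + dg j)%N != N -> L i j = 0 &
       forall i, G i iT = (i == iT)%:R]].
Proof.
move=> dgN Mgr Mh Mu dg0 dgT MT M0.
pose s k : C := if odd (k * (N - k)) then 'i else 1.
have s2 k : s k * s k = (- 1) ^+ (k * (N - k)).
  by rewrite /s -signr_odd; case: odd; rewrite ?mul1r // -expr2 sqrCi expr1.
have sC k : (s k)^* * s k = 1.
  rewrite /s; case: odd; last by rewrite conjC1 mul1r.
  by rewrite conjCi mulNr -expr2 sqrCi opprK.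
(* This symmetry lets the diagonal matrix [S] commute with every matrix that exchanges degrees k and
   N - k. *)
have sN k l : (k + l)%N = N -> s k = s l.
  by move=> kl; rewrite /s -kl addKn addnK mulnC.
have s0 : s 0%N = 1 by rewrite /s mul0n.
have sN0 : s N = 1 by rewrite /s subnn muln0.
pose S : 'M[C]_n := diag_mx (\row_i s (dg i)).
have [H HM] : exists H, H = S *m M by exists (S *m M).
have HE i j : H i j = s (dg i) * M i j by rewrite HM mul_diag_mx !mxE.
have Hgr i j : (dg i + dg j)%N != N -> H i j = 0 by move=> ij; rewrite HE Mgr // mulr0.
have Hh : H^t* = H.
  apply/matrixP => i j; rewrite !mxE !HE rmorphM /= Mh.
  have [ij|ij] := eqVneq (dg i + dg j)%N N; last by rewrite (Mgr _ _ ij) !mulr0.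
  rewrite mulrA (_ : (- 1) ^+ _ = s (dg j) * s (dg j)); last first.
    by rewrite s2 -ij addnK mulnC.
  by rewrite (mulrA (s _)^*) sC mul1r (sN _ _ ij).
have Su : S \in unitmx.
  rewrite unitmxE det_diag unitfE; apply/prodf_neq0 => i _; rewrite mxE.
  by apply: contra_eq_neq (sC (dg i)) => ->; rewrite mulr0 eq_sym oner_neq0.
have Hu : H \in unitmx by rewrite HM unitmx_mul Su.
have [E [J /=]] := hermitian_polar Hh Hu.
have [G GE] : exists G, G = E^t* *m E by exists (E^t* *m E).
rewrite -GE => -[Eu JJ Jh JH [HJ comG fixG]].
(* Commutation with [X] and [X'] encodes homogeneity. *)
pose X : 'M[C]_n := diag_mx (\row_i (dg i)%:R).
pose X' : 'M[C]_n := diag_mx (\row_i (N - dg i)%:R).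
have HX : H *m X = X' *m H.
  apply/matrixP => i j; rewrite mul_mx_diag mul_diag_mx !mxE.
  have [ij|ij] := eqVneq (dg i + dg j)%N N; last by rewrite (Hgr _ _ ij) mulr0 mul0r.
  by rewrite -ij addKn mulrC.
have HX' : H *m X' = X *m H.
  apply/matrixP => i j; rewrite mul_mx_diag mul_diag_mx !mxE.
  have [ij|ij] := eqVneq (dg i + dg j)%N N; last by rewrite (Hgr _ _ ij) mulr0 mul0r.
  by rewrite -ij addnK mulrC.
have GX : X *m G = G *m X by apply: comG; rewrite mulmxA -HX' -!mulmxA HX.
have JX : X *m J = J *m X'.
  by apply: (can_inj (mulmxK Hu)); rewrite -!mulmxA JH GX -JH -mulmxA HX.
have Ggr i j : dg i != dg j -> G i j = 0.
  move=> ij; move/matrixP/(_ i j): GX; rewrite mul_mx_diag mul_diag_mx !mxE.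
  move/eqP; rewrite mulrC -subr_eq0 -mulrBr mulf_eq0 => /orP[/eqP //|].
  by rewrite subr_eq0 eqr_nat (negbTE ij).
have Jgr i j : (dg i + dg j)%N != N -> J i j = 0.
  move=> ij; move/matrixP/(_ i j): JX; rewrite mul_mx_diag mul_diag_mx !mxE.
  move/eqP; rewrite mulrC -subr_eq0 -mulrBr mulf_eq0 => /orP[/eqP //|].
  by rewrite subr_eq0 eqr_nat -(eqn_add2r (dg j)) subnK // (negbTE ij).
have comS (K : 'M[C]_n) : (forall i j, (dg i + dg j)%N != N -> K i j = 0) -> K *m S = S *m K.
  move=> Kgr; apply/matrixP => i j; rewrite mul_mx_diag mul_diag_mx !mxE.
  have [ij|ij] := eqVneq (dg i + dg j)%N N; last by rewrite (Kgr _ _ ij) mulr0 mul0r.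
  by rewrite (sN _ _ ij) mulrC.
exists E, (S *m J) => /=; rewrite -GE; split=> //.
- by rewrite mulmxA comS // -HM HJ.
- rewrite trmx_mul map_mxM Jh !mulmxA.
  have SGS : S^t* *m G *m S = G.
    apply/matrixP => i j; rewrite tr_diag_mx map_diag_mx mul_mx_diag mul_diag_mx !mxE.
    have [ij|ij] := eqVneq (dg i) (dg j); last by rewrite (Ggr _ _ ij) mulr0 mul0r.
    by rewrite ij mulrAC sC mul1r.
  by rewrite -!mulmxA (mulmxA _ G) (mulmxA _ S) SGS -JH mulmxA mulmxA JJ mul1mx HJ.
- move=> i j; rewrite -mulmxA (mulmxA J) (comS J Jgr) -mulmxA JJ mulmx1 mul_diag_mx.
  rewrite !mxE; have [->|ij] := eqVneq i j; last by rewrite mulr0n mulr0 mul0r.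
  by rewrite mulr1n s2 mul1r.
- split=> // [i j ij|i].
    by rewrite mul_diag_mx [in LHS]mxE Jgr // mulr0.
  (* H carries the vector of index [iT] to that of index [i0] and back: these columns of M are unit
     vectors, and [s] is 1 in degrees 0 and N. *)
  have HHv : H *m H *m delta_mx iT 0 = delta_mx iT (0 : 'I_1).
    have He j k : (forall i, M i j = (i == k)%:R) -> s (dg k) = 1 ->
        H *m delta_mx j 0 = delta_mx k (0 : 'I_1).
      move=> Mj sk; rewrite -colE; apply/colP => l; rewrite !mxE HE Mj eqxx andbT.
      by have [->|] := eqVneq l k; rewrite ?mulr0 // sk mulr1.
    by rewrite -mulmxA (He _ i0) ?dg0 // (He _ iT) // dgT.
  by have := fixG _ HHv; rewrite -colE => /colP/(_ i); rewrite !mxE eqxx andbT.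
Qed.

End HermitianMatrix.

(** * The Haar integral *)

Section SemidefiniteForm.
Context {C : numClosedFieldType} {V : lmodType C} (q : V -> V -> C).
Hypotheses (qr : forall x c y z, q x (c *: y + z) = c * q x y + q x z)
  (ql : forall x c y z, q (c *: y + z) x = c^* * q y x + q z x)
  (q_ge0 : forall x, 0 <= q x x).

Lemma semidef_expand c x y : q (c *: y + x) (c *: y + x) =
  c^* * c * q y y + (c^* * q y x + c * q x y) + q x x.
Proof. by rewrite ql !qr mulrDr !mulrA !addrA. Qed.

(** Polarisation: diagonal values are real, hence so is the cross term for c = 1 and c = 'i, and
    these two conditions determine q y x. A Haar integral is given only as positive, so hermitian
    symmetry must be derived. *)
Lemma semidef_hermitian x y : q y x = (q x y)^*.
Proof.
have re c : (c^* * q y x + c * q x y)^* = c^* * q y x + c * q x y.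
  apply/CrealP.
  have := ger0_real (q_ge0 (c *: y + x)); rewrite semidef_expand.
  have cc : c^* * c * q y y \is Num.real.
    by rewrite ger0_real // mulr_ge0 // mulrC mul_conjC_ge0.
  move=> qq; have := rpredB (rpredB qq cc) (ger0_real (q_ge0 x)).
  by rewrite addrAC addrK addrC addKr.
apply: (can_inj (@conjCK C)); rewrite conjCK.
have := re 1; have := re 'i.
rewrite !(rmorphD, rmorphM) /= !conjCi !mul1r rmorphN /= conjCi opprK => e1 e2.
have i0 := neq0Ci C.
move: e1; rewrite !mulNr [X in _ = X]addrC -!mulrBr => /(mulfI i0) e1.
have aux (u v u' v' : C) : u' + v' = u + v -> u' - v' = v - u -> u' = v.
  move=> e e'; have := congr2 +%R e e'.
  have -> : u' + v' + (u' - v') = 2 * u' by ring.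
  have -> : u + v + (v - u) = 2 * v by ring.
  by apply: mulfI; rewrite pnatr_eq0.
by rewrite !conjC1 !mul1r in e2; exact: aux e2 e1.
Qed.

(** The degenerate case of the Cauchy-Schwarz inequality. *)
Lemma semidef_null x y : q y y = 0 -> q x y = 0.
Proof.
move=> y0; apply/eqP/negPn/negP => nz.
set u := q x y in nz; have n0 : 0 < u * u^* by rewrite mul_conjC_gt0.
(* Moving x by - t conj(u) y lowers q x x by 2 t |u|^2; this [t] brings the value down to - (q x x +
   2), which is negative. *)
have [t t_ge0 tE] : exists2 t, 0 <= t & t * (u * u^*) = q x x + 1.
  exists ((q x x + 1) / (u * u^* )); last by rewrite divfK ?gt_eqF.
  by rewrite divr_ge0 ?addr_ge0 // ltW.
have /CrealP tr := ger0_real t_ge0.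
have := q_ge0 ((- t * u^*) *: y + x).
rewrite semidef_expand y0 mulr0 add0r (semidef_hermitian x y) -/u.
rewrite !(rmorphM, rmorphN) /= conjCK tr.
have -> : - t * u * u^* + - t * u^* * u + q x x = - 2 * (t * (u * u^*)) + q x x by ring.
rewrite tE.
have -> : -2 * (q x x + 1) + q x x = - (q x x + 2) by ring.
by rewrite oppr_ge0 lt_geF // ltr_wpDl.
Qed.

End SemidefiniteForm.

(** * Sweedler calculus and faithfulness of the Haar integral *)

Section Hopf.
Context {R : realType} {A : algType R[i]} (H : hopf_star_algebra A).
Local Notation Delta := (comul H).
Local Notation S := (antipode H).
Local Notation eps := (counit H).

Lemma comul_assoc (U : lmodType R[i]) (f : A -> A -> A -> U) a :
  (forall y z, linear (fun x => f x y z)) ->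
  (forall x z, linear (fun y => f x y z)) -> (forall x y, linear (f x y)) ->
  tlift (fun x z => tlift (fun x1 x2 => f x1 x2 z) (Delta x)) (Delta a) =
  tlift (fun x z => tlift (f x) (Delta z)) (Delta a).
Proof. by move=> f1 f2 f3; apply: tlift_assoc => //; apply: comulA. Qed.

Lemma tlift_counitl (U : lmodType R[i]) (f : A -> U) a : linear f ->
  tlift (fun x y => eps x *: f y) (Delta a) = f a.
Proof.
move=> fl; rewrite -[in RHS](counitl H a) (lin_tlift _ _ fl).
by apply: eq_tlift => x y; rewrite (linear_onZ fl).
Qed.

Lemma tlift_counitr (U : lmodType R[i]) (f : A -> U) a : linear f ->
  tlift (fun x y => eps y *: f x) (Delta a) = f a.
Proof.
move=> fl; rewrite -[in RHS](counitr H a) (lin_tlift _ _ fl).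
by apply: eq_tlift => x y; rewrite (linear_onZ fl).
Qed.

Lemma tlift_antipodel (U : lmodType R[i]) (f : A -> U) a : linear f ->
  tlift (fun x y => f (S x * y)) (Delta a) = eps a *: f 1.
Proof. by move=> fl; rewrite -(lin_tlift _ _ fl) antipodel (linear_onZ fl). Qed.

Lemma tlift_antipoder (U : lmodType R[i]) (f : A -> U) a : linear f ->
  tlift (fun x y => f (x * S y)) (Delta a) = eps a *: f 1.
Proof. by move=> fl; rewrite -(lin_tlift _ _ fl) antipoder (linear_onZ fl). Qed.

Section Haar.
Variable (h : {scalar A}).
Hypothesis haar_h : haar_integral H h.

(* Strong left invariance: [a_1 h(b a_2) = S(b_1) h(b_2 a)]. *)
Lemma haar_strong_inv a b :
  tlift (fun x y => h (b * y) *: x) (Delta a) =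
  tlift (fun x y => h (y * a) *: S x) (Delta b).
Proof.
(* Both sides equal S(b_1) b_2 a_1 h(b_3 a_2): cancelling S(b_1) b_2 gives the left one, left
   invariance of h at [y * a] the right one. *)
transitivity (tlift (fun x y => tlift (fun y1 y2 =>
    tlift (fun a1 a2 => h (y2 * a2) *: (S x * y1 * a1)) (Delta a)) (Delta y)) (Delta b)).
  pose F u z := tlift (fun a1 a2 => h (z * a2) *: (u * a1)) (Delta a).
  have F1 z : linear (F^~ z) by lin.
  have F2 u : linear (F u) by lin.
  rewrite -(comul_assoc (f := fun x y z => F (S x * y) z)); [|by lin..].
  under [RHS]eq_tlift => x y do rewrite (tlift_antipodel _ (F1 y)).
  rewrite (tlift_counitl _ (F2 1)).
  by apply: eq_tlift => x y; rewrite mul1r.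
apply: eq_tlift => x y.
have := haar_invl haar_h (y * a); rewrite rmorphM tlift_mul; last by lin.
move/(congr1 ( *%R (S x))); rewrite -[in X in _ = X]scalerAr mulr1 => <-.
rewrite lin_tlift; last by lin.
apply: eq_tlift => u v; rewrite lin_tlift; last by lin.
by apply: eq_tlift => u' v'; rewrite -scalerAr mulrA.
Qed.

Lemma hstar_lin c a b : hstar H (c *: a + b) = c^* *: hstar H a + hstar H b.
Proof. exact: hstar_conj_linear. Qed.

Let q (x y : A) := h (hstar H x * y).

Let qr x c y z : q x (c *: y + z) = c * q x y + q x z.
Proof. by rewrite /q mulrDr -scalerAr linearP. Qed.

Let ql x c y z : q (c *: y + z) x = c^* * q y x + q z x.
Proof. by rewrite /q hstar_lin mulrDl -scalerAl linearP. Qed.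

Lemma haar_star_mul a b : h (hstar H b * a) = (h (hstar H a * b))^*.
Proof. exact: (semidef_hermitian qr ql (haar_ge0 haar_h)). Qed.

Lemma hstar1 : hstar H 1 = 1.
Proof. by rewrite -[RHS](hstarK H) -[in RHS](mul1r (hstar H 1)) hstarM hstarK mul1r. Qed.

(* The left kernel of [h] is a left ideal and, by strong left invariance, a left subcomodule; the antipode then shows that the counit vanishes on it. *)
Lemma haar_faithful a : h (hstar H a * a) = 0 -> a = 0.
Proof.
move=> a0; pose null x := forall b, h (b * x) = 0.
have na : null a.
  by move=> b; rewrite -[b](hstarK H); apply: (semidef_null qr ql (haar_ge0 haar_h)).
have null_legs x : null x -> exists n (v w : 'I_n -> A),
    Delta x = \sum_i tpure (v i) (w i) /\ forall i, null (w i).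
  move=> nx; have [n [v [w [DE ind]]]] := tens_indep (Delta x).
  exists n, v, w; split=> // i b; move: i; apply: ind.
  (* By strong invariance the sum of the h(b w_i) v_i is a combination of values h(y x), all zero;
     independence of the v_i isolates each h(b w_i). *)
  have := haar_strong_inv x b.
  have b1 : bilin (fun x y : A => h (b * y) *: x) by lin.
  have [T TE] := linear_pack (tlift_lin b1).
  rewrite -TE DE linear_sum; under eq_bigr => i _ do
    rewrite TE (tlift_pure (bilin_balanced b1)).
  move=> ->; rewrite /tlift big1 // => p _; by rewrite nx scale0r.
have null_eps x : null x -> eps x = 0.
  move=> nx; have [n [v [w [DE nw]]]] := null_legs x nx.
  (* The counit of x is h(S(x_1) x_2), and the right legs are null. *)
  have := congr1 h (antipodel H x); rewrite linearZ /= (haar1 haar_h) mulr1 => <-.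
  have b1 : bilin (fun x y : A => S x * y) by lin.
  have [T TE] := linear_pack (tlift_lin b1).
  rewrite -TE DE !linear_sum big1 // => i _.
  by rewrite TE (tlift_pure (bilin_balanced b1)) nw.
have [n [v [w [DE nw]]]] := null_legs a na.
rewrite -(counitr H a).
have b1 : bilin (fun x y : A => eps y *: x) by lin.
have [T TE] := linear_pack (tlift_lin b1).
rewrite -TE DE linear_sum big1 // => i _.
by rewrite TE (tlift_pure (bilin_balanced b1)) null_eps // scale0r.
Qed.

End Haar.
End Hopf.

(** * Left-invariant forms *)

Section Comodule.
Context {R : realType} {A : algType R[i]} {H : hopf_star_algebra A}.
Context {Omega : algType R[i]} (calc : star_diff_calculus H Omega).
Local Notation inc := (incl calc).
Local Notation d := (extd calc).
Local Notation star := (gstar calc).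
Local Notation rho := (coact calc).
Local Notation Delta := (comul H).
Local Notation S := (antipode H).
Local Notation eps := (counit H).

Lemma gr_incl a : gr calc 0 (inc a).
Proof. by rewrite incl_gr0; exists a. Qed.

Lemma gr_incl_mul k a w : gr calc k w -> gr calc k (inc a * w).
Proof. by move=> kw; rewrite -[k]add0n; apply: grM => //; apply: gr_incl. Qed.

Lemma gr_dincl a : gr calc 1 (d (inc a)).
Proof. exact/extd_gr/gr_incl. Qed.

Lemma gr_prod_dincl k (a : 'I_k -> A) : gr calc k (\prod_(i < k) d (inc (a i))).
Proof.
elim: k a => [|k IHk] a.
  by rewrite big_ord0 -(rmorph1 inc); apply: gr_incl.
by rewrite big_ord_recl; apply: (grM (gr_dincl _) (IHk _)).
Qed.

(** The a and da generate the calculus, so properties of the coaction need checking only there. The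
    degree is carried along because the involution reverses products with a sign depending on
    degrees. *)
Lemma gr_calc_ind (Q : nat -> Omega -> Prop) :
  (forall k c u v, gr calc k u -> gr calc k v -> Q k u -> Q k v -> Q k (c *: u + v)) ->
  (forall k l u v, gr calc k u -> gr calc l v -> Q k u -> Q l v -> Q (k + l)%N (u * v)) ->
  (forall a, Q 0%N (inc a)) -> (forall a, Q 1%N (d (inc a))) ->
  forall k w, gr calc k w -> Q k w.
Proof.
move=> QD QM Qi Qd; case=> [|k] w.
  by rewrite incl_gr0 => -[a _ <-].
have Qp n (a : 'I_n -> A) : Q n (\prod_(i < n) d (inc (a i))).
  elim: n a => [|n IHn] a; first by rewrite big_ord0 -(rmorph1 inc); apply: Qi.
  by rewrite big_ord_recl; apply: (QM 1%N n); [exact: gr_dincl|exact: gr_prod_dincl|exact: Qd|exact: IHn].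
rewrite gr_span // => -[n [c [x [xS ->]]]].
have Qx i : gr calc k.+1 (x i) /\ Q k.+1 (x i).
  have [a0 [a ->]] := xS i; split; first exact/gr_incl_mul/gr_prod_dincl.
  by apply: (QM 0%N k.+1) => //; [exact: gr_incl|exact: gr_prod_dincl].
(* The starting value of the sum is produced as a product with the factor [inc 0]. *)
have Q0 : Q k.+1 0.
  have := QM 0%N k.+1 (inc 0) _ (gr_incl 0) (gr_prod_dincl (fun=> 0)) (Qi 0) (Qp k.+1 (fun=> 0)).
  by rewrite rmorph0 mul0r.
suff [] : gr calc k.+1 (\sum_i c i *: x i) /\ Q k.+1 (\sum_i c i *: x i) by [].
have gsub := gr_subspace calc k.+1.
elim/big_rec: _ => [|i y _ [gy Qy]]; first by split => //; exact: subspace0.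
have [gx Qxi] := Qx i; split; last exact: QD.
by apply: gsub.2.
Qed.

Lemma gr_sum_ind (Q : Omega -> Prop) :
  Q 0 -> (forall u v, Q u -> Q v -> Q (u + v)) ->
  (forall k w, gr calc k w -> Q w) -> forall w, Q w.
Proof.
move=> Q0 QD Qg w; have [n [f [fg ->]]] := gr_sum calc w.
by apply: (big_ind Q) => // i _; apply: Qg (fg i).
Qed.

Lemma calc_ind (Q : Omega -> Prop) :
  (forall c u v, Q u -> Q v -> Q (c *: u + v)) ->
  (forall u v, Q u -> Q v -> Q (u * v)) ->
  (forall a, Q (inc a)) -> (forall a, Q (d (inc a))) -> forall w, Q w.
Proof.
move=> QD QM Qi Qd; apply: gr_sum_ind.
- by rewrite -(rmorph0 inc); apply: Qi.
- by move=> u v Qu Qv; rewrite -[u]scale1r; apply: QD.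
- by move=> k w; apply: (@gr_calc_ind (fun _ => Q)) => *; [apply: QD|apply: QM|apply: Qi|apply: Qd].
Qed.

Lemma coact_dincl a : rho (d (inc a)) = tmap idfun d (tmap idfun inc (Delta a)).
Proof. by rewrite -coact_extd coact_incl. Qed.

Lemma tlift_coact_incl (U : lmodType R[i]) (f : A -> Omega -> U) a : bilin f ->
  tlift f (rho (inc a)) = tlift (fun x y => f x (inc y)) (Delta a).
Proof. by move=> fb; rewrite coact_incl tlift_tmap. Qed.

Lemma tlift_coact_dincl (U : lmodType R[i]) (f : A -> Omega -> U) a : bilin f ->
  tlift f (rho (d (inc a))) = tlift (fun x y => f x (d (inc y))) (Delta a).
Proof.
case=> f1 f2; rewrite coact_dincl tlift_tmap; last by split.
rewrite tlift_tmap //; split=> [w|v]; first exact: f1.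
by move=> c x y; rewrite linearP f2.
Qed.

Lemma tlift_coactM (U : lmodType R[i]) (f : A -> Omega -> U) u v : bilin f ->
  tlift f (rho (u * v)) =
  tlift (fun x w => tlift (fun x' w' => f (x * x') (w * w')) (rho v)) (rho u).
Proof. by move=> fb; rewrite rmorphM tlift_mul. Qed.

(** The counit law is inherited from [Delta] on the generators a and da; it passes to products
    because eps is a character. *)
Lemma coact_counit w : tlift (fun x u => eps x *: u) (rho w) = w.
Proof.
have eb : bilin (fun x (u : Omega) => eps x *: u) by lin.
elim/calc_ind: w => [c u v IHu IHv|u v IHu IHv|a|a].
- by rewrite linearP (tlift_lin eb) IHu IHv.
- rewrite tlift_coactM // -[in RHS]IHu -[in RHS]IHv.
  rewrite (lin_tlift _ _ (lin_mull _ lin_id)).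
  apply: eq_tlift => x w; rewrite (lin_tlift _ _ (lin_mulr _ lin_id)).
  by apply: eq_tlift => x' w'; rewrite rmorphM -scalerAl -scalerAr scalerA.
- by rewrite tlift_coact_incl // tlift_counitl //; lin.
- by rewrite tlift_coact_dincl // (tlift_counitl H (f := fun y => d (inc y))) //; lin.
Qed.

(* Coassociativity is stated after composition with a trilinear map because [A (x) (A (x) Omega)] carries no ring structure here. *)
Lemma coact_assoc (U : lmodType R[i]) (f : A -> A -> Omega -> U) w :
  (forall y z, linear (fun x => f x y z)) ->
  (forall x z, linear (fun y => f x y z)) -> (forall x y, linear (f x y)) ->
  tlift (fun x z => tlift (fun x1 x2 => f x1 x2 z) (Delta x)) (rho w) =
  tlift (fun x z => tlift (f x) (rho z)) (rho w).
Proof.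
elim/calc_ind: w U f => [c u v IHu IHv|u v IHu IHv|a|a] U f f1 f2 f3.
- have b1 : bilin (fun x z => tlift (fun x1 x2 => f x1 x2 z) (Delta x)) by lin.
  have b2 : bilin (fun x z => tlift (f x) (rho z)) by lin.
  by rewrite linearP (tlift_lin b1) (tlift_lin b2) IHu // IHv.
- rewrite !tlift_coactM; [|by lin..].
  (* The trilinear map is translated by the legs of one factor, so that the induction hypotheses,
     valid for all trilinear maps, apply to [u] and then to [v]. *)
  transitivity (tlift (fun x w => tlift (fun x1 x2 =>
      tlift (fun x' w' => tlift (fun x1' x2' => f (x1 * x1') (x2 * x2') (w * w'))
        (Delta x')) (rho v)) (Delta x)) (rho u)).
    apply: eq_tlift => x w; rewrite tlift_exchange; apply: eq_tlift => x' w'.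
    by rewrite rmorphM tlift_mul //; lin.
  rewrite IHu; [|by lin..].
  apply: eq_tlift => x w; rewrite [RHS](_ : _ = tlift (fun x' w' => tlift (fun y u0 =>
     tlift (fun y' u' => f (x * x') (y * y') (u0 * u')) (rho w')) (rho w)) (rho v)); last first.
    by apply: eq_tlift => x' w'; rewrite tlift_coactM //; lin.
  rewrite [RHS]tlift_exchange; apply: eq_tlift => y u0.
  by rewrite (IHv _ (fun a b c => f (x * a) (y * b) (u0 * c))) //; lin.
- rewrite !tlift_coact_incl; [|by lin..].
  rewrite (comul_assoc H (f := fun x y z => f x y (inc z))); [|by lin..].
  by apply: eq_tlift => x y; rewrite tlift_coact_incl //; lin.
- rewrite !tlift_coact_dincl; [|by lin..].
  rewrite (comul_assoc H (f := fun x y z => f x y (d (inc z)))); [|by lin..].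
  by apply: eq_tlift => x y; rewrite tlift_coact_dincl //; lin.
Qed.

End Comodule.

(** * The projection onto left-invariant forms *)

Section InvariantProjection.
Context {R : realType} {A : algType R[i]} {H : hopf_star_algebra A}.
Context {Omega : algType R[i]} (calc : star_diff_calculus H Omega).
Local Notation inc := (incl calc).
Local Notation d := (extd calc).
Local Notation star := (gstar calc).
Local Notation rho := (coact calc).
Local Notation Delta := (comul H).
Local Notation S := (antipode H).
Local Notation eps := (counit H).

Lemma coactM u v : rho (u * v) = rho u * rho v.
Proof. exact: rmorphM. Qed.

Lemma coactZ c u : rho (c *: u) = c *: rho u.
Proof. exact: linearZ. Qed.

Lemma coactD u v : rho (u + v) = rho u + rho v.
Proof. exact: linearD. Qed.

(** Preservation of degree by the coaction follows from its values on A and its compatibility with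
    d. *)
Lemma coact_gr k w : gr calc k w -> tens_in (gr calc k) (rho w).
Proof.
elim/(@gr_calc_ind _ _ _ _ calc): k w / => [k c u v _ _ IHu IHv|k l u v _ _ IHu IHv|a|a].
- by rewrite linearP; apply: tens_inD => //; apply: tens_inZ.
- rewrite rmorphM; apply: tens_in_mul IHu IHv => x y; exact: grM.
- rewrite coact_incl; apply: tens_in_map (tens_inT _) => y _; exact: gr_incl.
- rewrite coact_dincl; apply: (@tens_in_map _ _ _ _ _ (gr calc 0)).
    by move=> w; apply: extd_gr.
  by apply: tens_in_map (tens_inT _) => y _; exact: gr_incl.
Qed.

Let tstar := tmap (hstar H) star.

Let gstarZ c u : star (c *: u) = c^* *: star u.
Proof. exact/conj_linearZ/gstar_conj_linear. Qed.

Let tstar_bal : tens_balanced (fun a w => tpure (hstar H a) (star w)).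
Proof. apply: conj_tens_balanced; [exact: hstar_conj_linear|exact: gstar_conj_linear]. Qed.

Let tstar_pure a w : tstar (tpure a w) = tpure (hstar H a) (star w).
Proof. exact: tlift_pure tstar_bal _ _. Qed.

Let tstarD : {morph tstar : t u / t + u}.
Proof. exact: tliftD tstar_bal. Qed.

Let tstar0 : tstar 0 = 0.
Proof. exact: tlift0 tstar_bal. Qed.

Let tstarZ c t : tstar (c *: t) = c^* *: tstar t.
Proof.
elim/(@tens_ind R[i] A Omega): t => [|a w|t u IHt IHu].
- by rewrite scaler0 tstar0 scaler0.
- by rewrite -tpureZr !tstar_pure gstarZ tpureZr.
- by rewrite scalerDr !tstarD IHt IHu scalerDr.
Qed.

Let tstarM k l t u : tens_in (gr calc k) t -> tens_in (gr calc l) u ->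
  tstar (t * u) = (- 1) ^+ (k * l) *: (tstar u * tstar t).
Proof.
elim=> [|a w kw|t1 t2 _ IH1 _ IH2] ul.
- by rewrite mul0r tstar0 mulr0 scaler0.
- elim: ul => [|b v lv|u1 u2 _ IH1 _ IH2].
  + by rewrite mulr0 tstar0 mul0r scaler0.
  + by rewrite tpureM !tstar_pure tpureM (gstarM kw lv) hstarM tpureZr.
  + by rewrite mulrDr !tstarD IH1 IH2 mulrDl scalerDr.
- by rewrite mulrDl !tstarD IH1 // IH2 // mulrDr scalerDr.
Qed.

Let tstar_incl t : tstar (tmap idfun inc t) = tmap idfun inc (tmap (hstar H) (hstar H) t).
Proof.
have hb := conj_tens_balanced (hstar_conj_linear H) (hstar_conj_linear H).
have /bilin_balanced ib : bilin (fun (a : A) b => tpure (idfun a) (inc b)) by lin.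
elim/(@tens_ind R[i] A A): t => [|a b|t u IHt IHu]; first by rewrite /tmap !tlift0.
  by rewrite /tmap !tlift_pure // tstar_pure incl_star.
by move: IHt IHu; rewrite /tmap (tliftD hb) !(tliftD ib) tstarD => -> ->.
Qed.

Let tstar_extd t : tstar (tmap idfun d t) = tmap idfun d (tstar t).
Proof.
have /bilin_balanced db : bilin (fun (a : A) b => tpure (idfun a) (d b)) by lin.
elim/(@tens_ind R[i] A Omega): t => [|a w|t u IHt IHu].
- by rewrite /tmap tlift0 // !tstar0 tlift0.
- by rewrite /tmap !tlift_pure // !tstar_pure tlift_pure // extd_star.
- by move: IHt IHu; rewrite /tmap tstarD !(tliftD db) tstarD => -> ->.
Qed.

(** On A this is [comul_star]; it passes to da because d commutes with [star], and to products
    because the sign in [tstarM] depends only on the degrees of the right legs, which [coact_gr]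
    controls. *)
Lemma coact_star k w : gr calc k w -> rho (star w) = tstar (rho w).
Proof.
elim/(@gr_calc_ind _ _ _ _ calc): k w / => [k c u v _ _ IHu IHv|k l u v ku lv IHu IHv|a|a].
- by rewrite gstar_conj_linear !(coactD, coactZ) tstarD tstarZ IHu IHv.
- by rewrite (gstarM ku lv) coactZ !coactM IHu IHv (tstarM (coact_gr ku) (coact_gr lv)).
- by rewrite incl_star !coact_incl comul_star tstar_incl.
- by rewrite -extd_star incl_star !coact_dincl comul_star -tstar_incl tstar_extd.
Qed.

Lemma inv_star k w : inv_gr calc k w -> inv_gr calc k (star w).
Proof.
case=> kw iw; split; first exact: gstar_gr.
rewrite /inv_form /= (coact_star kw) iw tstar_pure.
by rewrite hstar1.
Qed.

Definition inv_proj w : Omega := tlift (fun x u => inc (S x) * u) (rho w).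
Local Notation P := inv_proj.

Let Pbil : bilin (fun x u => inc (S x) * u).
Proof. by lin. Qed.

Lemma inv_proj_lin : linear P.
Proof. by rewrite /P; apply: lin_tlift_app => //; lin. Qed.

(** Coassociativity makes x and S(y) two legs of one coproduct, and the antipode cancels them. Every
    form is thus an A-combination of invariant ones. *)
Lemma inv_projK w : tlift (fun x u => inc x * P u) (rho w) = w.
Proof.
under eq_tlift => x u do rewrite mulr_tlift.
rewrite -(coact_assoc calc (f := fun x y v => inc x * (inc (S y) * v))); [|by lin..].
rewrite -[RHS](coact_counit calc); apply: eq_tlift => x v.
have fl : linear (fun y => inc y * v) by lin.
under eq_tlift => x1 x2 do rewrite mulrA -rmorphM.
by rewrite (tlift_antipoder H _ fl) rmorph1 mul1r.
Qed.

(** The cancellation of S(a_1) a_2; it is what makes coefficients in A unique. *)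
Lemma inv_proj_incl a w : inv_form calc w -> P (inc a * w) = eps a *: w.
Proof.
move=> iw; rewrite /P coactM coact_incl iw.
rewrite tlift_mul // tlift_tmap; last by lin.
have b a' w' : bilin (fun a u => inc (S (a' * a)) * (w' * u)) by lin.
under eq_tlift => x y do rewrite (tlift_pure (bilin_balanced (b _ _))) mulr1 mulrA -rmorphM.
have fl : linear (fun y => inc y * w) by lin.
by rewrite (tlift_antipodel H _ fl) rmorph1 mul1r.
Qed.

Lemma inv_proj_id w : inv_form calc w -> P w = w.
Proof. by move=> /(inv_proj_incl 1); rewrite !rmorph1 mul1r scale1r. Qed.

Lemma gr_inv_proj k w : gr calc k w -> gr calc k (P w).
Proof.
move/coact_gr; rewrite /P; have gs := gr_subspace calc k.
elim=> [|a u ku|t t' _ IH1 _ IH2]; first by rewrite (tlift0 (bilin_balanced Pbil)); exact: subspace0.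
  by rewrite (tlift_pure (bilin_balanced Pbil)); apply: gr_incl_mul.
by rewrite (tliftD (bilin_balanced Pbil)); apply: subspaceD.
Qed.

(* [Delta(S(x_1)) (x_2 (x) 1) = 1 (x) S(x)]; this replaces the anti-comultiplicativity of [S]. *)
Let coact_antipode x : tlift (fun x1 x2 => rho (inc (S x1)) * tpure x2 1) (Delta x) =
  tpure 1 (inc (S x)).
Proof.
(* With this identity x_2 (x) 1 becomes Delta(x_2) (1 (x) S(x_3)), whose coproduct merges with
   Delta(S(x_1)) and cancels. *)
have cancel y : tlift (fun y1 y2 => rho (inc y1) * tpure 1 (inc (S y2))) (Delta y) = tpure y 1.
  transitivity (tlift (fun y1 y2 => tlift (fun z1 z2 =>
      tpure z1 (inc z2) * tpure 1 (inc (S y2))) (Delta y1)) (Delta y)).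
    by apply: eq_tlift => y1 y2; rewrite coact_incl /tmap tmull_tlift.
  rewrite (comul_assoc H (f := fun z1 z2 y2 => tpure z1 (inc z2) * tpure 1 (inc (S y2)))); [|by lin..].
  have fl : linear (fun z : A => tpure z (1 : Omega)) by lin.
  rewrite -(tlift_counitr H _ fl); apply: eq_tlift => z1 y2.
  have gl : linear (fun z => tpure z1 (inc z)) by lin.
  under eq_tlift => z2 z3 do rewrite tpureM mulr1 -rmorphM.
  by rewrite (tlift_antipoder H _ gl) rmorph1.
under eq_tlift => x1 x2 do rewrite -cancel tmulr_tlift.
rewrite -(comul_assoc H (f := fun x1 x2 x3 =>
  rho (inc (S x1)) * (rho (inc x2) * tpure 1 (inc (S x3))))); [|by lin..].
have fl : linear (fun y => tpure (1 : A) (inc (S y))) by lin.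
rewrite -(tlift_counitl H _ fl); apply: eq_tlift => y x3.
have gl : linear (fun y => rho (inc y) * tpure 1 (inc (S x3))) by lin.
under eq_tlift => x1 x2 do rewrite mulrA -!rmorphM.
by rewrite (tlift_antipodel H _ gl) !rmorph1 mul1r.
Qed.

(** Coassociativity turns the coaction of S(x) u into Delta(S(x_1)) (x_2 (x) v); splitting off 1 (x)
    v leaves the expression of [coact_antipode]. *)
Lemma inv_projP w : inv_form calc (P w).
Proof.
have rho_lin : linear rho by exact: linearP.
have pure_lin : linear (@tpure R[i] A Omega 1) by exact: (tpure_bilin _ _).2.
rewrite /inv_form /= /P (lin_tlift _ _ rho_lin).
transitivity (tlift (fun x u => tlift (fun y v => rho (inc (S x)) * tpure y v) (rho u)) (rho w)).
  apply: eq_tlift => x u; rewrite coactM -{1}[rho u]tlift_tpure.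
  by rewrite tmulr_tlift.
rewrite -(coact_assoc calc (f := fun x y v => rho (inc (S x)) * tpure y v)); [|by lin..].
rewrite (lin_tlift _ _ pure_lin); apply: eq_tlift => x v.
transitivity (tlift (fun x1 x2 => rho (inc (S x1)) * tpure x2 1) (Delta x) * tpure 1 v).
  rewrite tmull_tlift; apply: eq_tlift => x1 x2.
  by rewrite -mulrA tpureM mulr1 mul1r.
by rewrite coact_antipode tpureM mul1r.
Qed.

End InvariantProjection.

(** The generating set [S] need not be a subspace, as is the case for homogeneous vectors. Adjoining
    missing elements of [S] stops at the dimension. *)
Lemma free_extension (F : fieldType) (vT : vectType F) (S : vT -> Prop) (X : seq vT) :
  free X -> {in X, forall x, S x} ->
  (forall U : {vspace vT}, (forall x, S x -> x \in U) -> U = fullv) ->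
  exists Y : seq vT, [/\ free Y, <<Y>>%VS = fullv, {in Y, forall x, S x} & {subset X <= Y}].
Proof.
move=> fX SX Sfull.
have [k] := ubnP (\dim {:vT} - size X).
elim: k X fX SX => // k IHk X fX SX ltk.
have [Xfull|] := pselect (forall x, S x -> x \in <<X>>%VS).
  by exists X; split=> //; apply: Sfull.
move=> /existsNP[x /not_implyP[Sx /negP xX]].
have fxX : free (x :: X) by rewrite free_cons xX.
have szX : (size X < \dim {:vT})%N.
  by rewrite -[(size X).+1]/(size (x :: X)) -(eqP fxX) dimvS // subvf.
have [||Y [fY Yfull SY XY]] := IHk _ fxX.
- by move=> y; rewrite inE => /orP[/eqP -> //|]; apply: SX.
- by rewrite /= subnS prednK ?subn_gt0 //; apply: leq_trans ltk _; rewrite ?ltnS.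
by exists Y; split=> // y yX; apply: XY; rewrite inE yX orbT.
Qed.

(** * A homogeneous basis of the invariant forms and coordinates in A *)

Section HomogeneousBasis.
Context {R : realType} {A : algType R[i]} {H : hopf_star_algebra A}.
Context {Omega : algType R[i]} (calc : star_diff_calculus H Omega).
Local Notation inc := (incl calc).
Local Notation d := (extd calc).
Local Notation star := (gstar calc).
Local Notation rho := (coact calc).
Local Notation Delta := (comul H).
Local Notation eps := (counit H).
Local Notation P := (inv_proj calc).

Lemma inv_form1 : inv_form calc 1.
Proof. by rewrite /inv_form /= rmorph1. Qed.

Lemma inv_gr1 : inv_gr calc 0 1.
Proof. by split; [rewrite -(rmorph1 inc); apply: gr_incl|exact: inv_form1]. Qed.

Lemma inv_gr0_scalar w : inv_gr calc 0 w -> exists c, w = c *: 1.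
Proof.
case; rewrite incl_gr0 => -[a _ <-] ia; exists (eps a).
by rewrite -(inv_proj_incl _ inv_form1) mulr1 inv_proj_id.
Qed.

Lemma gstar1 : star 1 = 1.
Proof. by rewrite -(rmorph1 inc) incl_star hstar1. Qed.

Lemma is_subspace_inv_gr k : is_subspace (inv_gr calc k).
Proof.
split=> [|c u v [ku iu] [kv iv]].
  split; first exact: (subspace0 (gr_subspace _ _)).
  by rewrite /inv_form /= linear0 (linear_on0 ((tpure_bilin _ _).2 _)).
split; first exact: (gr_subspace calc k).2.
rewrite /inv_form /= coactD coactZ iu iv.
by rewrite -(tpure_bilin _ _).2.
Qed.

(** For a generator b, either b + b^* is a nonzero self-adjoint form, or b^* = - b and 'i b is
    self-adjoint. No norm is prescribed, the inner product being still to be chosen. For N = 0 the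
    choice theta = 1 lets one basis vector play both roles. *)
Lemma volume_form N : has_dim (inv_gr calc N) 1 ->
  exists theta, [/\ inv_gr calc N theta, theta != 0, star theta = theta,
    N = 0%N -> theta = 1 & forall w, inv_gr calc N w -> exists c, w = c *: theta].
Proof.
case=> b [b_ind bN].
have bE w : inv_gr calc N w -> exists c, w = c *: b ord0.
  rewrite bN => -[n [c [x [xb ->]]]]; exists (\sum_i c i).
  rewrite scaler_suml; apply: eq_bigr => i _.
  by have [j _ <-] := xb i; rewrite ord1.
have Nb : inv_gr calc N (b ord0).
  rewrite bN; exists 1%N, (fun=> 1), (fun=> b ord0); split; first by move=> _; exists ord0.
  by rewrite big_ord1 scale1r.
have b0 : b ord0 != 0.
  apply/eqP => b0; have := b_ind (fun=> 1); rewrite big_ord1 b0 scaler0 => /(_ erefl ord0)/eqP.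
  by rewrite oner_eq0.
have scale_b w : inv_gr calc N w -> w != 0 ->
    forall v, inv_gr calc N v -> exists c, v = c *: w.
  move=> Nw w0 v Nv; have [c wE] := bE w Nw; have [c' ->] := bE v Nv.
  exists (c' / c); rewrite wE scalerA divfK //.
  by apply: contraNneq w0 => c0; rewrite wE c0 scale0r.
have [N0|N0] := eqVneq N 0%N.
  have N1 : inv_gr calc N 1 by rewrite N0; apply: inv_gr1.
  exists 1; split=> //; [exact: oner_neq0|exact: gstar1|].
  by apply: scale_b => //; exact: oner_neq0.
have starD u v : star (u + v) = star u + star v.
  exact/conj_linearD/gstar_conj_linear.
have Nsub := is_subspace_inv_gr N.
have [bb|bb] := eqVneq (b ord0 + star (b ord0)) 0.
  have Nib : inv_gr calc N ('i *: b ord0) by apply: (subspaceZ Nsub).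
  have ib0 : 'i *: b ord0 != 0 by rewrite scaler_eq0 negb_or neq0Ci.
  exists ('i *: b ord0); split=> //; last exact: scale_b.
    rewrite (conj_linearZ (gstar_conj_linear calc)) conjCi.
    by move: bb => /eqP; rewrite addrC addr_eq0 => /eqP ->; rewrite scalerN scaleNr opprK.
  by move=> N0'; rewrite N0' in N0.
have Nbb : inv_gr calc N (b ord0 + star (b ord0)).
  by apply: (subspaceD Nsub) => //; apply: inv_star.
exists (b ord0 + star (b ord0)); split=> //; last exact: scale_b.
  by rewrite starD gstarK addrC.
by move=> N0'; rewrite N0' in N0.
Qed.

(** The homogeneous components are replaced by their projections, which keep their degrees and add
    up to P w = w. *)
Lemma inv_form_gr_sum w : inv_form calc w -> exists n (f : 'I_n -> Omega) ,
  (forall i, exists k, inv_gr calc k (f i)) /\ w = \sum_i f i.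
Proof.
move=> iw; have [n [f [fg wE]]] := gr_sum calc w.
exists n, (fun i => P (f i)); split=> [i|].
  by exists (i : nat); split; [exact: gr_inv_proj|exact: inv_projP].
have [P' PE] := linear_pack (inv_proj_lin calc).
by rewrite -(inv_proj_id iw) {1}wE -PE linear_sum; apply: eq_bigr => i _; rewrite PE.
Qed.

Definition homogeneous_basis n (e : 'I_n -> Omega) (dg : 'I_n -> nat) : Prop :=
  [/\ forall i, inv_gr calc (dg i) (e i),
      forall c : 'I_n -> R[i], \sum_i c i *: e i = 0 -> forall i, c i = 0
    & forall w, inv_form calc w -> exists c : 'I_n -> R[i], w = \sum_i c i *: e i].

(** Invariant forms are transported to row vectors, where a free family can be completed. The seed
    consists of 1 and theta, whose presence fixes two columns of the pairing matrix. *)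
Lemma exists_homogeneous_basis N theta : strongly_finite_dim calc ->
  inv_gr calc N theta -> theta != 0 -> (N = 0%N -> theta = 1) ->
  exists n (e : 'I_n -> Omega) dg i0 iT,
    [/\ homogeneous_basis e dg, e i0 = 1 & e iT = theta].
Proof.
move=> [m [b [b_ind bV]]] Nth th0 N1.
pose phi_ (x : 'rV[R[i]]_m) := \sum_i x 0 i *: b i.
have [phi phiE] : exists phi : {linear 'rV[R[i]]_m -> Omega}, phi =1 phi_.
  apply: linear_pack => c x y; rewrite /phi_ scaler_sumr -big_split /=.
  by apply: eq_bigr => i _; rewrite !mxE scalerDl scalerA.
have phi_inj x : phi x = 0 -> x = 0.
  by rewrite phiE => /b_ind xb; apply/rowP => i; rewrite mxE xb.
have phiV w : inv_form calc w -> exists x, w = phi x.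
  rewrite bV => -[n [c [x [xb ->]]]].
  have /choice[y yE] : forall i, exists y, x i = phi y.
    move=> i; have [j _ <-] := xb i; exists (delta_mx 0 j).
    rewrite phiE /phi_ (bigD1 j) //= mxE !eqxx scale1r big1 ?addr0 // => l lj.
    by rewrite mxE (negbTE lj) andbF scale0r.
  exists (\sum_i c i *: y i); rewrite linear_sum; apply: eq_bigr => i _.
  by rewrite linearZ yE.
pose S x := exists k, inv_gr calc k (phi x).
have [x1 x1E] := phiV _ inv_form1; have [xt xtE] := phiV _ Nth.2.
have x10 : x1 != 0 by apply: contra_eq_neq x1E => ->; rewrite linear0 oner_neq0.
have Sx1 : S x1 by exists 0%N; rewrite -x1E; apply: inv_gr1.
have Sxt : S xt by exists N; rewrite -xtE.
have Sfull (U : {vspace 'rV[R[i]]_m}) : (forall x, S x -> x \in U) -> U = fullv.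
  move=> SU; apply/vspaceP => x; rewrite memvf.
  have [|n [f [fg]]] := @inv_form_gr_sum (phi x).
    by rewrite phiE bV; exists m, (fun i => x 0 i), b; split=> // i; exists i.
  have /choice[y yE] : forall i, exists y, f i = phi y.
    by move=> i; have [k [_ /phiV]] := fg i.
  under eq_bigr => i _ do rewrite yE.
  rewrite -linear_sum => /eqP; rewrite -subr_eq0 -linearB => /eqP/phi_inj/eqP.
  rewrite subr_eq0 => /eqP ->; apply: memv_suml => i _; apply: SU.
  by have [k] := fg i; rewrite yE; exists k.
have [X [fX SX x1X xtX]] : exists X : seq 'rV[R[i]]_m,
    [/\ free X, {in X, forall x, S x}, x1 \in X & xt \in X].
  have [N0|N0] := eqVneq N 0%N.
    exists [:: x1]; rewrite !inE; split=> //.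
    - by rewrite free_cons span_nil memv0 x10 nil_free.
    - by move=> x; rewrite inE => /eqP ->.
    - rewrite -subr_eq0; apply/eqP/phi_inj; rewrite linearB -xtE -x1E N1 //.
      by rewrite subrr.
  exists [:: xt; x1]; rewrite !inE !eqxx ?orbT; split=> //; last first.
    by move=> x; rewrite !inE => /orP[]/eqP ->.
  rewrite free_cons free_cons span_nil memv0 x10 nil_free !andbT span_seq1.
  apply/vlineP => -[c xtc]; case/negP: th0; apply/eqP.
  have thc : theta = c *: 1 by rewrite x1E -linearZ -xtc.
  have [th _] := Nth.
  (* Were theta a multiple of 1, - theta in degree 0 and theta in degree N would be a vanishing
     homogeneous sum, and directness would give theta = 0. *)
  have := @gr_direct _ _ calc N.+1 (fun k => if k == 0%N then - theta else if k == N then theta else 0).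
  case: N N0 th {N1 Nth Sxt} => // N _ th; rewrite big_ord_recl big_ord_recr /= big1 ?add0r; last first.
    by move=> i _; rewrite /bump /= add1n eqSS ltn_eqF.
  move=> gd; have := gd _ _ N.+1; rewrite /= eqxx; apply=> //.
    case=> [|k] /=; last by case: eqP => [->//|_]; exact: (subspace0 (gr_subspace _ _)).
    rewrite thc -scaleNr; apply: (subspaceZ (gr_subspace _ _)).
    by case: inv_gr1.
  by rewrite addNr.
have [Y [fY Yfull SY XY]] := free_extension fX SX Sfull.
have memY x : x \in Y -> (index x Y < size Y)%N by rewrite index_mem.
have /choice[dg dgE] : forall i : 'I_(size Y), exists k, inv_gr calc k (phi Y`_i).
  by move=> i; apply: SY; rewrite mem_nth.
exists (size Y), (fun i => phi Y`_i), dg, (Ordinal (memY _ (XY _ x1X))),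
  (Ordinal (memY _ (XY _ xtX))).
split; [split=> //| |].
- have /freeP fYP : free (in_tuple Y) by [].
  move=> c ce; apply: fYP.
  apply: phi_inj; rewrite linear_sum -[RHS]ce; apply: eq_bigr => i _.
  by rewrite linearZ.
- move=> w /phiV[x ->]; exists (fun i => coord (in_tuple Y) i x).
  have /coord_span {1}-> : x \in <<in_tuple Y>>%VS by rewrite /= Yfull memvf.
  by rewrite linear_sum; apply: eq_bigr => i _; rewrite linearZ.
- by rewrite /= nth_index ?XY // -x1E.
- by rewrite /= nth_index ?XY // -xtE.
Qed.

Section Coordinates.
Context {n : nat} {e : 'I_n -> Omega} {dg : 'I_n -> nat}.
Hypothesis e_basis : homogeneous_basis e dg.

Lemma basis_gr i : gr calc (dg i) (e i).
Proof. by case: e_basis => eg _ _; case: (eg i). Qed.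

Lemma basis_inv i : inv_form calc (e i).
Proof. by case: e_basis => eg _ _; case: (eg i). Qed.

Lemma basis_inj (c c' : 'I_n -> R[i]) :
  \sum_i c i *: e i = \sum_i c' i *: e i -> c =1 c'.
Proof.
case: e_basis => _ ind _ /eqP; rewrite -subr_eq0 -sumrB => /eqP cc i.
apply/eqP; rewrite -subr_eq0; apply/eqP; move: i; apply: ind.
by rewrite -[RHS]cc; apply: eq_bigr => i _; rewrite scalerBl.
Qed.

Lemma exists_inv_coord : exists q : 'I_n -> {scalar Omega},
  forall w, P w = \sum_i q i w *: e i.
Proof.
have /choice[q qE] : forall w, exists c : 'I_n -> R[i], P w = \sum_i c i *: e i.
  by case: e_basis => _ _ sp w; apply: sp; apply: inv_projP.
have qlin i : scalar (q^~ i).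
  move=> c u v; move: i; apply: basis_inj; rewrite -qE inv_proj_lin !qE.
  rewrite scaler_sumr -big_split /=; apply: eq_bigr => j _.
  by rewrite scalerDl scalerA.
have /choice[q' q'E] : forall i, exists g : {scalar Omega}, g =1 q^~ i.
  by move=> i; apply: scalar_pack.
by exists q' => w; rewrite qE; apply: eq_bigr => i _; rewrite q'E.
Qed.

(* [C i w = q_i(w_(0)) w_(-1)], where [q_i w] is the i-th coordinate of [inv_proj w]. *)
Lemma exists_coord : exists C : 'I_n -> {linear Omega -> A},
  (forall w, w = \sum_i inc (C i w) * e i) /\
  (forall i a j, C i (inc a * e j) = (i == j)%:R *: a).
Proof.
have [q qE] := exists_inv_coord.
have qe i j y : q i (inc y * e j) = eps y * (i == j)%:R.
  move: i; apply: basis_inj.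
  rewrite -qE (inv_proj_incl _ (basis_inv j)) (bigD1 j) //= eqxx mulr1.
  by rewrite big1 ?addr0 // => i ij; rewrite (negbTE ij) mulr0 scale0r.
have qb i : bilin (fun (x : A) u => q i u *: x) by lin.
have /choice[C CE] : forall i, exists g : {linear Omega -> A},
    g =1 fun w => tlift (fun (x : A) u => q i u *: x) (rho w).
  by move=> i; apply: linear_pack => c u v; rewrite coactD coactZ (tlift_lin (qb i)).
exists C; split=> [w|i a j].
  rewrite -{1}(inv_projK calc w) /tlift.
  under eq_bigr => p _ do rewrite qE mulr_sumr.
  rewrite exchange_big; apply: eq_bigr => i _.
  rewrite CE /tlift linear_sum mulr_suml; apply: eq_bigr => p _.
  by rewrite linearZ -scalerAl -scalerAr.
rewrite CE coactM (basis_inv j) coact_incl tlift_mul // tlift_tmap; last by lin.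
have b (x : A) (u : Omega) : bilin (fun x' u' => q i (u * u') *: (x * x')) by lin.
under eq_tlift => x y do rewrite (tlift_pure (bilin_balanced (b _ _))) mulr1 qe.
have fl : linear (fun x : A => (i == j)%:R *: x) by lin.
rewrite -(tlift_counitr H _ fl); apply: eq_tlift => x y.
by rewrite scalerA.
Qed.

End Coordinates.
End HomogeneousBasis.

(** * The Hodge operator *)

Section Hodge.
Context {R : realType} {A : algType R[i]} {H : hopf_star_algebra A}.
Context {h : {scalar A}} {Omega : algType R[i]} (calc : star_diff_calculus H Omega).
Context {N n : nat} {theta : Omega} {e : 'I_n -> Omega} {dg : 'I_n -> nat}.
Context {i0 iT : 'I_n} {C : 'I_n -> {linear Omega -> A}}.
Hypotheses (haar_h : haar_integral H h) (dim_calc : calc_dim calc N)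
  (nondeg_calc : non_degenerate calc N)
  (extd_inv : forall k w, k.+1 = N -> inv_gr calc k w -> extd calc w = 0)
  (e_basis : homogeneous_basis calc e dg) (e0 : e i0 = 1) (eT : e iT = theta)
  (theta_star : gstar calc theta = theta) (theta_gr : inv_gr calc N theta)
  (theta_span : forall w, inv_gr calc N w -> exists c, w = c *: theta)
  (coord_sum : forall w, w = \sum_i incl calc (C i w) * e i)
  (coord_basis : forall i a j, C i (incl calc a * e j) = (i == j)%:R *: a).
Local Notation inc := (incl calc).
Local Notation d := (extd calc).
Local Notation star := (gstar calc).
Local Notation rho := (coact calc).
Local Notation Delta := (comul H).
Local Notation integ w := (h (C iT w)).
Local Notation eg := (basis_gr e_basis).
Local Notation ei := (basis_inv e_basis).

Lemma coord_incl_mul i a w : C i (inc a * w) = a * C i w.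
Proof.
rewrite {1}(coord_sum w) mulr_sumr linear_sum (bigD1 i) //= mulrA -rmorphM.
rewrite coord_basis eqxx scale1r big1 ?addr0 // => j ji.
by rewrite mulrA -rmorphM coord_basis eq_sym (negbTE ji) scale0r.
Qed.

Lemma coord_e i j : C i (e j) = (i == j)%:R *: 1.
Proof. by rewrite -[e j]mul1r -(rmorph1 inc) coord_basis. Qed.

Lemma coord_inj u v : (forall i, C i u = C i v) -> u = v.
Proof. by move=> uv; rewrite (coord_sum u) (coord_sum v); under eq_bigr => i _ do rewrite uv. Qed.

(** Directness of the grading is applied to [f]: the degree-l part of the expansion of w, with w
    itself subtracted in degree k. The total is zero, so every [f l] is. *)
Lemma coord_gr k w i : gr calc k w -> dg i != k -> C i w = 0.
Proof.
move=> kw ik.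
pose f l := \sum_j (dg j == l)%:R *: (inc (C j w) * e j) - (l == k)%:R *: w.
(* [B] exceeds k and all degrees of the basis, so the sum misses no component. *)
pose B := (\max_j dg j + k).+1.
have ltB j : (dg j < B)%N by rewrite ltnS (leq_trans (leq_bigmax j)) ?leq_addr.
have pickB m (x : Omega) : (m < B)%N -> \sum_(l < B) (m == l :> nat)%:R *: x = x.
  move=> mB; rewrite (bigD1 (Ordinal mB)) //= eqxx scale1r big1 ?addr0 // => l ml.
  by rewrite eq_sym (negbTE (ml : val l != m)) scale0r.
have fgr l : gr calc l (f l).
  have gl := gr_subspace calc l; rewrite /f -scaleNr; apply: (subspaceD gl).
    apply: (subspace_sum gl) => j _; case: eqP => [<-|_]; last first.
      by rewrite scale0r; apply: subspace0 gl.
    by rewrite scale1r; apply/gr_incl_mul/eg.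
  by case: eqP => [->|_]; [apply: (subspaceZ (gr_subspace _ _))|rewrite oppr0 scale0r; apply: subspace0 gl].
have fsum : \sum_(l < B) f l = 0.
  rewrite /f sumrB exchange_big /=.
  under eq_bigr => j _ do rewrite pickB //.
  rewrite -coord_sum; under eq_bigr => l _ do rewrite eq_sym.
  by rewrite pickB ?subrr // ltnS leq_addl.
have := gr_direct fgr fsum (ltB i); rewrite /f (negbTE ik) scale0r subr0.
move/(congr1 (C i)); rewrite linear_sum linear0 (bigD1 i) //= eqxx scale1r coord_basis eqxx.
rewrite scale1r big1 ?addr0 // => j ji.
by rewrite linearZ /= coord_basis (eq_sym i) (negbTE ji) scale0r scaler0.
Qed.

Lemma e_neq0 i : e i != 0.
Proof.
apply/eqP => ei0; have := coord_e i i; rewrite ei0 linear0 eqxx scale1r => /esym/eqP.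
by rewrite oner_eq0.
Qed.

Lemma coord_dg k i : gr calc k (e i) -> dg i = k.
Proof.
move=> ki; apply/eqP/negPn/negP => /(coord_gr ki); rewrite coord_e eqxx scale1r => /eqP.
by rewrite oner_eq0.
Qed.

Lemma dg_le i : (dg i <= N)%N.
Proof.
rewrite leqNgt; apply/negP => Ni; have := e_neq0 i.
by rewrite (dim_calc.2 _ _ Ni (eg i)) eqxx.
Qed.

Lemma dg0 : dg i0 = 0%N.
Proof. by apply: coord_dg; rewrite e0; case: (inv_gr1 calc). Qed.

Lemma dgT : dg iT = N.
Proof. by apply: coord_dg; rewrite eT; case: theta_gr. Qed.

Lemma e_proportional i j c : e i = c *: e j -> i = j.
Proof.
move=> eij; apply/eqP/negPn/negP => ij.
have := coord_e i i; rewrite eij linearZ /= coord_e (negbTE ij) eqxx scale0r scaler0 scale1r.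
by move/eqP; rewrite eq_sym oner_eq0.
Qed.

Lemma dg_eq0 i : dg i = 0%N -> i = i0.
Proof.
move=> di; have [|c ec] := @inv_gr0_scalar _ _ _ _ calc (e i).
  by rewrite -di; split; [exact: eg|exact: ei].
by apply: (@e_proportional _ _ c); rewrite e0.
Qed.

Lemma dg_eqN i : dg i = N -> i = iT.
Proof.
move=> di; have [|c ec] := @theta_span (e i).
  by rewrite -di; split; [exact: eg|exact: ei].
by apply: (@e_proportional _ _ c); rewrite eT.
Qed.

(** * Left invariance of the integral and vanishing on exact forms *)

Lemma integ_gr k w : gr calc k w -> k != N -> integ w = 0.
Proof. by move=> kw kN; rewrite (coord_gr kw) ?linear0 // dgT eq_sym. Qed.

Lemma integ_theta a : integ (inc a * theta) = h a.
Proof. by rewrite -eT coord_basis eqxx scale1r. Qed.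

Lemma integ_top w : inv_gr calc N w -> w = integ w *: theta.
Proof.
move=> /theta_span[c ->]; rewrite !linearZ /= -[theta in RHS]mul1r -[in RHS](rmorph1 inc).
by rewrite integ_theta (haar1 haar_h) mulr1 rmorph1 mul1r.
Qed.

(** The e_i are invariant, so the coaction only touches the coefficients in A, where left invariance
    of h applies. *)
Lemma integ_coact w : tlift (fun x u => integ u *: x) (rho w) = (integ w)%:A.
Proof.
have b : bilin (fun (x : A) u => integ u *: x) by lin.
have [T TE] := linear_pack (tlift_lin b).
rewrite -TE {1}(coord_sum w) !linear_sum.
have -> : (integ w)%:A = \sum_i (if i == iT then (integ w)%:A else 0) :> A.
  by rewrite -big_mkcond big_pred1_eq.
apply: eq_bigr => i _; rewrite /= TE coactM ei coact_incl tlift_mul // tlift_tmap; last by lin.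
have b' (x : A) (u : Omega) : bilin (fun x' u' => integ (u * u') *: (x * x')) by lin.
under eq_tlift => x y do rewrite (tlift_pure (bilin_balanced (b' _ _))) mulr1 coord_basis linearZ /=.
have [->|_] := eqVneq iT i.
  by under eq_tlift => x y do rewrite mul1r; rewrite (haar_invl haar_h).
by rewrite /tlift big1 // => p _; rewrite mul0r scale0r.
Qed.

(* [F] is colinear, so that [int o F] is a left-invariant functional on [A], hence a multiple of [h]. *)
Lemma integ_covariant (F : {linear A -> Omega}) :
  (forall a, rho (F a) = tmap idfun F (Delta a)) ->
  forall a, integ (F a) = h a * integ (F 1).
Proof.
move=> Fcov a.
have := integ_coact (F a); rewrite Fcov tlift_tmap; last by lin.
move/(congr1 h); rewrite linearZ /= (haar1 haar_h) mulr1 => <-.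
have := congr1 (fun x => integ (F x)) (haar_invr haar_h a).
rewrite !linearZ /= => <-; rewrite /tlift !linear_sum; apply: eq_bigr => p _.
by rewrite !linearZ /= mulrC.
Qed.

(** The coefficient stands between two forms and need not commute with [u]; it can be extracted
    because a -> u a v is colinear. *)
Lemma integ_mul_inv u v a : inv_form calc u -> inv_form calc v ->
  integ (u * (inc a * v)) = h a * integ (u * v).
Proof.
move=> iu iv; have Fl : linear (fun x => u * (inc x * v)) by lin.
have [F FE] := linear_pack Fl.
have Fb : bilin (fun (x : A) (y : A) => tpure x (F y)) by lin.
rewrite -FE integ_covariant ?FE ?rmorph1 ?mul1r // => x.
rewrite FE !coactM iu iv coact_incl /tmap tmull_tlift tmulr_tlift.
by apply: eq_tlift => y z; rewrite FE !tpureM mulr1 mul1r.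
Qed.

(** The map a -> d(a e_i) is colinear since the coaction commutes with d. Its integral is h(a) times
    that of d e_i, which is zero for e_i of degree N - 1. *)
Lemma integ_extd w : integ (d w) = 0.
Proof.
rewrite (coord_sum w) !linear_sum big1 // => i _.
have gri : gr calc (dg i).+1 (d (inc (C i w) * e i)) by apply/extd_gr/gr_incl_mul/eg.
have [di|di] := eqVneq (dg i).+1 N; last exact: integ_gr gri di.
have Fl : linear (fun x => d (inc x * e i)) by lin.
have [F FE] := linear_pack Fl.
rewrite /= -FE integ_covariant ?FE ?rmorph1 ?mul1r => [|x].
  by rewrite (extd_inv di) ?linear0 ?mulr0 //; split; [exact: eg|exact: ei].
rewrite FE -coact_extd coactM ei coact_incl [tmap _ inc _]/tmap tmull_tlift.
rewrite (lin_tlift _ _ (tmap_lin _ _)) [RHS]/tmap; apply: eq_tlift => y z.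
rewrite tpureM mulr1 /tmap tlift_pure ?FE //.
by apply: bilin_balanced; lin.
Qed.

Lemma integ_star_top w : inv_gr calc N w -> integ (star w) = (integ w)^*.
Proof.
move=> Nw; have starZ := conj_linearZ (gstar_conj_linear calc).
rewrite {1}(integ_top Nw) starZ theta_star !linearZ /=.
rewrite -[theta]mul1r -(rmorph1 inc) integ_theta (haar1 haar_h).
exact: mulr1.
Qed.

Lemma inv_form_mul u v : inv_form calc u -> inv_form calc v -> inv_form calc (u * v).
Proof. by move=> iu iv; rewrite /inv_form /= coactM iu iv tpureM mulr1. Qed.

(** * The pairing matrix *)

Definition pairing_mx : 'M[R[i]]_n := \matrix_(i, j) integ (star (e i) * e j).
Local Notation M := pairing_mx.

Lemma star_e_gr i : inv_gr calc (dg i) (star (e i)).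
Proof. by apply: inv_star; split; [exact: eg|exact: ei]. Qed.

Lemma pairing_gr i j : (dg i + dg j)%N != N -> M i j = 0.
Proof.
move=> ij; rewrite mxE; apply: integ_gr ij.
by apply: grM (eg j); case: (star_e_gr i).
Qed.

Lemma pairing_conj i j : (M i j)^* = (- 1) ^+ (dg i * dg j) * M j i.
Proof.
have [ij|ij] := eqVneq (dg i + dg j)%N N; last first.
  by rewrite !pairing_gr ?conjC0 ?mulr0 // addnC.
have [gsi isi] := star_e_gr i.
rewrite !mxE -integ_star_top; last first.
  by split; [rewrite -ij; apply: grM (eg j)|apply: inv_form_mul (ei j)].
by rewrite (gstarM gsi (eg j)) gstarK !linearZ.
Qed.

(** Non-degeneracy speaks of homogeneous forms, so a kernel vector is cut down to its part w in one
    degree l. The integral of star (e_m) w vanishes for all m, hence so does that of e_m w. Since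
    the integral detects invariant top forms, all forms of degree N - l annihilate w. *)
Lemma pairing_unit : M \in unitmx.
Proof.
rewrite -unitmx_tr -row_free_unit; apply/inj_row_free => v vM.
have Mv i : \sum_j v 0 j * M i j = 0.
  have /rowP/(_ i) := vM; rewrite mxE [X in _ = X -> _]mxE => vMi.
  by rewrite -[RHS]vMi; apply: eq_bigr => j _; rewrite [M^T _ _]mxE.
apply/rowP => j0; rewrite mxE; set l := dg j0.
pose w := \sum_j ((dg j == l)%:R * v 0 j) *: e j.
have starsum := conj_linear_sum (gstar_conj_linear calc).
have starZ := conj_linearZ (gstar_conj_linear calc).
have wl : inv_gr calc l w.
  have ls := is_subspace_inv_gr calc l; apply: (subspace_sum ls) => j _.
  case: eqP => [jl|_]; last by rewrite mul0r scale0r; apply: subspace0 ls.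
  by apply: (subspaceZ ls); rewrite -jl; split; [exact: eg|exact: ei].
have star_w m : integ (star (e m) * w) = 0.
  rewrite /w mulr_sumr !linear_sum /=.
  under eq_bigr => j _ do rewrite -scalerAr !linearZ /= -[h _]/(integ _).
  have ME j : integ (star (e m) * e j) = M m j by rewrite mxE.
  under eq_bigr => j _ do rewrite ME.
  have [ml|ml] := eqVneq (dg m + l)%N N.
    rewrite -[RHS](Mv m); apply: eq_bigr => j _.
    have [_|jl] := eqVneq (dg j) l; first by rewrite mul1r.
    by rewrite pairing_gr ?mulr0 // -ml eqn_add2l.
  rewrite big1 // => j _; have [jl|_] := eqVneq (dg j) l; last by rewrite !mul0r.
  by rewrite pairing_gr ?mulr0 // jl.
have e_w m : integ (e m * w) = 0.
  have [y ymE] : exists y : 'I_n -> R[i], star (e m) = \sum_k y k *: e k.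
    by case: e_basis => _ _; apply; case: (star_e_gr m).
  rewrite -[e m](gstarK calc) ymE starsum mulr_suml !linear_sum big1 //= => k _.
  by rewrite starZ -scalerAl !linearZ /= star_w mulr0.
have w0 : w = 0.
  apply: (nondeg_calc (dg_le j0) wl.1) => w' w'gr.
  rewrite (coord_sum w') mulr_suml big1 // => i _; rewrite -mulrA.
  have [il|il] := eqVneq (dg i) (N - dg j0)%N; last first.
    by rewrite (coord_gr w'gr il) rmorph0 mul0r.
  rewrite (integ_top (w := e i * w)) ?e_w ?scale0r ?mulr0 //.
  split; last by apply: inv_form_mul (ei i) wl.2.
  by rewrite -(subnK (dg_le j0)) -il; apply: grM (eg i) wl.1.
have := e_basis; case=> _ ind _; have := ind _ w0 j0.
by rewrite eqxx mul1r.
Qed.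

(** Together with [pairing_0]: 1 and theta are dual to each other, and the other entries of their
    columns vanish for reasons of degree, V_0 and V_N being lines. *)
Lemma pairing_T i : M i iT = (i == i0)%:R.
Proof.
have [->|ii0] := eqVneq i i0.
  rewrite mxE e0 gstar1 mul1r eT -[theta]mul1r -(rmorph1 inc) integ_theta.
  exact: haar1 haar_h.
rewrite pairing_gr // dgT -[X in _ != X]add0n eqn_add2r.
by apply: contraNneq ii0 => /dg_eq0 ->.
Qed.

Lemma pairing_0 i : M i i0 = (i == iT)%:R.
Proof.
have [->|iiT] := eqVneq i iT.
  rewrite mxE e0 mulr1 eT theta_star -[theta]mul1r -(rmorph1 inc) integ_theta.
  exact: haar1 haar_h.
rewrite pairing_gr // dg0 addn0.
by apply: contraNneq iiT => /dg_eqN ->.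
Qed.

(** * The inner product defined by the Gram matrix G *)

Section HodgeOperator.
Context {E Lm : 'M[R[i]]_n}.
Local Notation G := ((map_mx Num.conj E^T) *m E).
Hypotheses (E_unit : E \in unitmx) (M_L : M *m Lm = G)
  (L_G_L : (map_mx Num.conj Lm^T) *m G *m Lm = G)
  (L_L : forall i j, (Lm *m Lm) i j = (i == j)%:R * (- 1) ^+ (dg i * (N - dg i)))
  (G_gr : forall i j, dg i != dg j -> G i j = 0)
  (L_gr : forall i j, (dg i + dg j)%N != N -> Lm i j = 0)
  (G_T : forall i, G i iT = (i == iT)%:R).

(** Written on all of Omega, this is already the induced inner product; on invariant forms, whose
    coordinates are scalars, it has Gram matrix G. Linearity in the first variable makes [G i j] the
    product of e_j with e_i. *)
Definition gram_form (u v : Omega) : R[i] :=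
  \sum_i \sum_j h (hstar H (C i v) * C j u) * G i j.
Local Notation ip := gram_form.

Lemma gram_formP c u v w : ip (c *: u + v) w = c * ip u w + ip v w.
Proof.
rewrite /ip mulr_sumr -big_split; apply: eq_bigr => i _ /=.
rewrite mulr_sumr -big_split; apply: eq_bigr => j _ /=.
by rewrite linearP mulrDr -scalerAr linearP mulrDl mulrA.
Qed.

Lemma gram_conj i j : (G i j)^* = G j i.
Proof.
rewrite !mxE rmorph_sum; apply: eq_bigr => k _ /=.
by rewrite !mxE rmorphM /= conjCK mulrC.
Qed.

Lemma gram_form_conj u v : ip v u = (ip u v)^*.
Proof.
rewrite /ip rmorph_sum exchange_big; apply: eq_bigr => i _ /=.
rewrite rmorph_sum; apply: eq_bigr => j _ /=.
by rewrite rmorphM /= gram_conj -(haar_star_mul haar_h).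
Qed.

Lemma gram_formZl c u w : ip (c *: u) w = c * ip u w.
Proof.
have ip0 : ip 0 w = 0.
  by rewrite /ip big1 // => i _; rewrite big1 // => j _; rewrite !linear0 mulr0 linear0 mul0r.
by rewrite -[c *: u]addr0 gram_formP ip0 addr0.
Qed.

Lemma gram_formZr c u w : ip w (c *: u) = c^* * ip w u.
Proof. by rewrite gram_form_conj gram_formZl rmorphM /= -gram_form_conj. Qed.

Lemma gram_formDl u v w : ip (u + v) w = ip u w + ip v w.
Proof. by rewrite -[u]scale1r gram_formP mul1r scale1r. Qed.

Lemma gram_formDr u v w : ip w (u + v) = ip w u + ip w v.
Proof. by rewrite gram_form_conj gram_formDl rmorphD /= -!gram_form_conj. Qed.

(** As coordinates lie in A, positivity of G is used through its factor E: the form becomes a sum of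
    terms h(y_k^* y_k), to which positivity and faithfulness of h apply. *)
Lemma gram_form_square u : ip u u =
  \sum_k h (hstar H (\sum_j E k j *: C j u) * (\sum_j E k j *: C j u)).
Proof.
have hsum := conj_linear_sum (hstar_conj_linear H).
have hZ := conj_linearZ (hstar_conj_linear H).
under [RHS]eq_bigr => k _.
  rewrite hsum mulr_suml linear_sum.
  under eq_bigr => i _.
    rewrite mulr_sumr linear_sum.
    under eq_bigr => j _ do rewrite hZ -scalerAl -scalerAr !linearZ /= mulrA mulrC.
    over.
  over.
rewrite exchange_big; apply: eq_bigr => i _ /=.
rewrite exchange_big; apply: eq_bigr => j _ /=.
rewrite -mulr_sumr; congr (_ * _).
by rewrite mxE; apply: eq_bigr => k _; rewrite !mxE.
Qed.

Lemma gram_form_gt0 u : u != 0 -> 0 < ip u u.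
Proof.
move=> u0; rewrite lt_neqAle eq_sym gram_form_square.
rewrite sumr_ge0 ?andbT; last by move=> k _; exact: haar_ge0 haar_h _.
apply: contra u0; rewrite psumr_eq0; last by move=> k _; exact: haar_ge0 haar_h _.
move=> /allP b0.
have {}b0 k : \sum_j E k j *: C j u = 0.
  by apply: (haar_faithful haar_h); apply/eqP/b0; rewrite mem_index_enum.
apply/eqP/coord_inj => i; rewrite linear0.
transitivity (\sum_j (invmx E *m E) i j *: C j u).
  rewrite mulVmx // (bigD1 i) //= mxE eqxx scale1r big1 ?addr0 // => j ji.
  by rewrite mxE eq_sym (negbTE ji) scale0r.
under eq_bigr => j _ do rewrite mxE scaler_suml.
rewrite exchange_big big1 //= => k _.
under eq_bigr => j _ do rewrite -scalerA.
by rewrite -scaler_sumr b0 scaler0.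
Qed.

Lemma gram_form_inner : inner_product_on setT ip.
Proof.
split=> [c u v w _ _ _|u v _ _|u _]; [exact: gram_formP|exact: gram_form_conj|exact: gram_form_gt0].
Qed.

Lemma gram_form_gr k l w w' : k <> l -> gr calc k w -> gr calc l w' -> ip w w' = 0.
Proof.
move=> kl kw lw'; rewrite /ip big1 // => i _; rewrite big1 // => j _.
have [jk|jk] := eqVneq (dg j) k; last by rewrite (coord_gr kw jk) mulr0 linear0 mul0r.
have [il|il] := eqVneq (dg i) l; last first.
  by rewrite (coord_gr lw' il) (conj_linear0 (hstar_conj_linear H)) mul0r linear0 mul0r.
by rewrite G_gr ?mulr0 // il jk eq_sym; apply/eqP.
Qed.

Lemma coord_inv w : inv_form calc w -> exists c : 'I_n -> R[i], forall i, C i w = c i *: 1.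
Proof.
case: e_basis => _ _ sp /sp[c ->]; exists c => i.
rewrite linear_sum (bigD1 i) //= linearZ /= coord_e eqxx scale1r big1 ?addr0 // => j ji.
by rewrite linearZ /= coord_e eq_sym (negbTE ji) scale0r scaler0.
Qed.

Lemma gram_form_incl a b w w' : inv_form calc w -> inv_form calc w' ->
  ip (inc a * w) (inc b * w') = h (hstar H b * a) * ip w w'.
Proof.
move=> /coord_inv[c cE] /coord_inv[c' c'E].
rewrite /ip mulr_sumr; apply: eq_bigr => i _; rewrite mulr_sumr; apply: eq_bigr => j _.
rewrite !coord_incl_mul !cE !c'E -!scalerAr !mulr1.
have hZ := conj_linearZ (hstar_conj_linear H).
rewrite !hZ hstar1 -!scalerAl -?scalerAr ?mul1r ?mulr1 !linearZ /= (haar1 haar_h) ?mulr1.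
by ring.
Qed.

Lemma gram_form_theta : ip theta theta = 1.
Proof.
rewrite /ip (bigD1 iT) //= [X in _ + X]big1 ?addr0 => [|i iiT]; last first.
  rewrite big1 // => j _; rewrite -eT !coord_e (negbTE iiT) scale0r.
  by rewrite (conj_linear0 (hstar_conj_linear H)) mul0r linear0 mul0r.
rewrite (bigD1 iT) //= [X in _ + X]big1 ?addr0 => [|j jiT]; last first.
  by rewrite -eT !coord_e (negbTE jiT) scale0r mulr0 linear0 mul0r.
by rewrite G_T eqxx mulr1 -eT coord_e eqxx scale1r mulr1 hstar1 (haar1 haar_h).
Qed.

(** * The Hodge operator and the codifferential *)

Context {L dstar : {linear Omega -> Omega}}.
(** The sign is forced by the required relation between L d and d^* L: a form v of degree m is
    (-1)^(m(N-m)) L (L v), and L v has degree N - m, so d^* v must be (-1)^(m(N-m)) (-1)^(N-m+1) L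
    (d (L v)). As it varies with the degree, [dstarE] inserts it on basis components. *)
Let sg (m : nat) : R[i] := (- 1) ^+ ((N - m).+1 + m * (N - m)).
Hypotheses
  (LE : forall w, L w = \sum_j inc (C j w) * (\sum_k Lm k j *: e k))
  (dstarE : forall w, dstar w =
    L (d (L (\sum_j sg (dg j) *: (inc (C j w) * e j))))).

Lemma hodge_incl a w : L (inc a * w) = inc a * L w.
Proof.
rewrite !LE mulr_sumr; apply: eq_bigr => j _.
by rewrite coord_incl_mul rmorphM mulrA.
Qed.

Lemma coord_hodge i w : C i (L w) = \sum_j Lm i j *: C j w.
Proof.
rewrite LE linear_sum; apply: eq_bigr => j _.
rewrite coord_incl_mul linear_sum (bigD1 i) //= linearZ /= coord_e eqxx scale1r.
rewrite big1 ?addr0 => [|k ki]; first by rewrite -scalerAr mulr1.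
by rewrite linearZ /= coord_e (eq_sym i) (negbTE ki) scale0r scaler0.
Qed.

(** The image of e_j under L, not the counit. *)
Let eps j := \sum_k Lm k j *: e k.

Let eps_gr j : inv_gr calc (N - dg j) (eps j).
Proof.
have Nsub := is_subspace_inv_gr calc (N - dg j); apply: (subspace_sum Nsub) => k _.
have [kj|kj] := eqVneq (dg k + dg j)%N N; last by rewrite L_gr // scale0r; apply: subspace0 Nsub.
by apply: (subspaceZ Nsub); rewrite -kj addnK; split; [exact: eg|exact: ei].
Qed.

Lemma hodge_gr k w : gr calc k w -> gr calc (N - k) (L w).
Proof.
move=> kw; have Nsub := gr_subspace calc (N - k); rewrite LE; apply: (subspace_sum Nsub) => j _.
have [<-|jk] := eqVneq (dg j) k; first by apply: gr_incl_mul; case: (eps_gr j).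
by rewrite (coord_gr kw jk) rmorph0 mul0r; apply: subspace0 Nsub.
Qed.

Lemma hodge_hodge k w : gr calc k w -> L (L w) = (- 1) ^+ (k * (N - k)) *: w.
Proof.
move=> kw; apply: coord_inj => i; rewrite coord_hodge linearZ /=.
under eq_bigr => j _ do rewrite coord_hodge scaler_sumr.
rewrite exchange_big /=.
transitivity (\sum_j (Lm *m Lm) i j *: C j w).
  apply: eq_bigr => j _; rewrite mxE scaler_suml; apply: eq_bigr => l _.
  by rewrite scalerA.
rewrite (bigD1 i) //= L_L eqxx mul1r big1 ?addr0 => [|j ji]; last first.
  by rewrite L_L eq_sym (negbTE ji) mul0r scale0r.
by have [->//|ik] := eqVneq (dg i) k; rewrite (coord_gr kw ik) !scaler0.
Qed.

Lemma hodge_bijective : bijective L.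
Proof.
have L4 w : L (L (L (L w))) = w.
  elim/(@gr_sum_ind _ _ _ _ calc): w => [|u v IHu IHv|k w kw]; first by rewrite !linear0.
    by rewrite !linearD /= IHu IHv.
  rewrite (hodge_hodge kw) !linearZ /= (hodge_hodge kw) scalerA -exprD addnn -mul2n.
  by rewrite exprM sqrrN !expr1n scale1r.
by exists (fun w => L (L (L w))) => w; rewrite L4.
Qed.

Lemma hodge_isometry u v : ip (L u) (L v) = ip u v.
Proof.
have hsum := conj_linear_sum (hstar_conj_linear H).
have hZ := conj_linearZ (hstar_conj_linear H).
pose Q l m := h (hstar H (C l v) * C m u).
transitivity (\sum_i \sum_j \sum_l \sum_m (Lm i l)^* * G i j * Lm j m * Q l m).
  apply: eq_bigr => i _; apply: eq_bigr => j _.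
  rewrite !coord_hodge hsum mulr_suml linear_sum mulr_suml; apply: eq_bigr => l _.
  rewrite mulr_sumr linear_sum mulr_suml; apply: eq_bigr => m _ /=.
  by rewrite hZ -scalerAl -scalerAr !linearZ /= /Q; ring.
transitivity (\sum_l \sum_m ((map_mx Num.conj Lm^T) *m G *m Lm) l m * Q l m); last first.
  by rewrite L_G_L; apply: eq_bigr => l _; apply: eq_bigr => m _; rewrite mulrC.
under eq_bigr => i _ do rewrite exchange_big /=.
rewrite exchange_big; apply: eq_bigr => l _ /=.
under eq_bigr => i _ do rewrite exchange_big /=.
rewrite exchange_big; apply: eq_bigr => m _ /=.
rewrite exchange_big mxE mulr_suml; apply: eq_bigr => j _ /=.
rewrite mxE !mulr_suml; apply: eq_bigr => i _ /=.
have -> : (map_mx Num.conj Lm^T) l i = (Lm i l)^* by rewrite !mxE.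
by [].
Qed.

(** For coefficients a and b, [integ_mul_inv] takes h(a^* b) out of the integral of e_i^* a^* b
    L(e_j); an entry of M Lm = G remains. *)
Lemma integ_hodge w w' : integ (star w * L w') = ip w' w.
Proof.
have starsum := conj_linear_sum (gstar_conj_linear calc).
rewrite {1}(coord_sum w) starsum mulr_suml !linear_sum; apply: eq_bigr => i _ /=.
rewrite LE mulr_sumr !linear_sum; apply: eq_bigr => j _ /=.
rewrite (gstarM (gr_incl calc _) (eg i)) mul0n expr0 scale1r incl_star.
have [_ isi] := star_e_gr i; have [_ ieps] := eps_gr j.
rewrite -mulrA [inc (hstar H _) * _]mulrA -rmorphM integ_mul_inv //; congr (_ * _).
rewrite -M_L mulr_sumr !linear_sum mxE; apply: eq_bigr => k _.
by rewrite -scalerAr !linearZ /= mulrC mxE.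
Qed.

Lemma codiff_gr_def k w : gr calc k w -> dstar w = sg k *: L (d (L w)).
Proof.
move=> kw; rewrite dstarE -!linearZ; do 3!congr (_ _).
rewrite {2}(coord_sum w) scaler_sumr; apply: eq_bigr => j _.
by have [->//|jk] := eqVneq (dg j) k; rewrite (coord_gr kw jk) rmorph0 mul0r !scaler0.
Qed.

Lemma gr_gtN k w : (N < k)%N -> gr calc k w -> w = 0.
Proof. exact: dim_calc.2. Qed.

(** Applying L removes the outer L of the codifferential, up to the sign of L^2 in degree N - m + 1.
    For m = 0 both sides vanish, d (L v) having degree N + 1. *)
Lemma hodge_codiff m v : gr calc m v -> L (dstar v) = (- 1) ^+ m *: d (L v).
Proof.
move=> mv; have [Nm|mN] := ltnP N m.
  by rewrite (gr_gtN Nm mv) !linear0 ?scaler0.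
rewrite (codiff_gr_def mv) linearZ /=.
have dL := extd_gr (hodge_gr mv).
case: m => [|m] in mv mN dL *.
  by rewrite (gr_gtN _ dL) ?subn0 // !linear0 ?scaler0.
have [k Nk] : exists k, N = (m.+1 + k)%N by exists (N - m.+1)%N; rewrite subnKC.
have e1 : (N - m.+1 = k)%N by rewrite Nk addKn.
have e2 : (N - k.+1 = m)%N by rewrite Nk addSnnS addnK.
rewrite (hodge_hodge dL) scalerA /sg e1 e2 -exprD; congr (_ *: _).
rewrite -[LHS]signr_odd -[RHS]signr_odd !oddD !oddM /=.
by case: (odd m); case: (odd k).
Qed.

Lemma codiff_hodge k w : gr calc k w -> L (d w) = (- 1) ^+ k.+1 *: dstar (L w).
Proof.
move=> kw; have [Nk|kN] := ltnP N k.
  by rewrite (gr_gtN Nk kw) !linear0 ?scaler0.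
rewrite (codiff_gr_def (hodge_gr kw)) (hodge_hodge kw) !linearZ /= !scalerA /sg subKn //.
rewrite -!exprD -signr_odd; set b := odd _; suff -> : b = false by rewrite scale1r.
rewrite /b addSn !oddD /= !oddD !oddM.
by case: (odd k); case: (odd (N - k)).
Qed.

Lemma codiff_gr k w : gr calc k.+1 w -> gr calc k (dstar w).
Proof.
move=> kw; have [Nk|kN] := ltnP N k.+1.
  by rewrite (gr_gtN Nk kw) linear0; apply: subspace0 (gr_subspace _ _).
rewrite (codiff_gr_def kw); apply: (subspaceZ (gr_subspace _ _)).
have := hodge_gr (extd_gr (hodge_gr kw)).
by rewrite subnSK // subKn // ltnW.
Qed.

Lemma codiff_gr0 w : gr calc 0 w -> dstar w = 0.
Proof.
move=> w0; rewrite (codiff_gr_def w0) (gr_gtN _ (extd_gr (hodge_gr w0))) ?subn0 //.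
by rewrite !linear0 ?scaler0.
Qed.

(** In adjacent degrees the integral of d(u^* L v) is zero, so that of (du)^* L v is (-1)^(k+1)
    times that of u^* d(L v), and [hodge_codiff] rewrites d(L v) as (-1)^(k+1) L(d^* v). In other
    degrees both sides vanish by orthogonality. Conjugation enters because [integ_hodge] puts the
    argument of L in the first slot. *)
Lemma codiff_adjoint : ip_adjoint ip d dstar.
Proof.
have ipr0 u : ip u 0 = 0 by rewrite -(scale0r u) gram_formZr conjC0 mul0r.
have ipl0 u : ip 0 u = 0 by rewrite -(scale0r u) gram_formZl mul0r.
move=> u v; elim/(@gr_sum_ind _ _ _ _ calc): u => [|u u' IHu IHu'|k u ku].
- by rewrite linear0 !ipl0.
- by rewrite linearD !gram_formDl IHu IHu'.
elim/(@gr_sum_ind _ _ _ _ calc): v => [|v v' IHv IHv'|m v mv].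
- by rewrite linear0 !ipr0.
- by rewrite linearD !gram_formDr IHv IHv'.
have [mk|mk] := eqVneq m k.+1; last first.
  rewrite (gram_form_gr _ (extd_gr ku) mv); last by move=> km; rewrite km eqxx in mk.
  case: m => [|m] in mv mk *; first by rewrite codiff_gr0.
  rewrite (gram_form_gr _ ku (codiff_gr mv)) // => km.
  by rewrite km eqxx in mk.
rewrite {}mk in mv; rewrite gram_form_conj [RHS]gram_form_conj -!integ_hodge; congr (_^*).
rewrite (hodge_codiff mv) -extd_star.
have := integ_extd (star u * L v); rewrite (extdM _ (gstar_gr ku)) !linearD /= !linearZ /=.
move/eqP; rewrite addr_eq0 => /eqP ->.
by rewrite -scalerAr !linearZ /= exprS mulN1r mulNr -mulrN.
Qed.

(** Moving L past d and past d^* costs the same sign twice. *)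
Lemma codiff_extd_hodge w : dstar (d (L w)) = L (d (dstar w)).
Proof.
elim/(@gr_sum_ind _ _ _ _ calc): w => [|u v IHu IHv|k w kw]; first by rewrite !linear0.
  by rewrite !linearD /= IHu IHv.
case: k => [|k] in kw *.
  by rewrite (codiff_gr0 kw) (gr_gtN _ (extd_gr (hodge_gr kw))) ?subn0 // !linear0.
rewrite (codiff_hodge (codiff_gr kw)) (hodge_codiff kw) linearZ /= scalerA -exprD addnn -mul2n.
by rewrite exprM sqrrN !expr1n scale1r.
Qed.

Lemma extd_codiff_hodge w : d (dstar (L w)) = L (dstar (d w)).
Proof.
elim/(@gr_sum_ind _ _ _ _ calc): w => [|u v IHu IHv|k w kw]; first by rewrite !linear0.
  by rewrite !linearD /= IHu IHv.
rewrite (hodge_codiff (extd_gr kw)) (codiff_hodge kw) linearZ /= scalerA -exprD addnn -mul2n.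
by rewrite exprM sqrrN !expr1n scale1r.
Qed.

(** L intertwines d^* d^* with d d up to sign. This removes the square terms of [laplacian], which
    is defined as a square. *)
Lemma codiff_codiff w : dstar (dstar w) = 0.
Proof.
elim/(@gr_sum_ind _ _ _ _ calc): w => [|u v IHu IHv|k w kw]; first by rewrite !linear0.
  by rewrite !linearD /= IHu IHv addr0.
case: k => [|k] in kw *; first by rewrite (codiff_gr0 kw) linear0.
apply: (bij_inj hodge_bijective).
rewrite (hodge_codiff (codiff_gr kw)) (hodge_codiff kw) linearZ /= extd_extd.
by rewrite !linear0 ?scaler0.
Qed.

Lemma laplacian_hodge w : L (laplacian d dstar w) = laplacian d dstar (L w).
Proof.
rewrite /laplacian !linearD /= !extd_extd !codiff_codiff !linear0 !add0r !addr0.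
by rewrite codiff_extd_hodge extd_codiff_hodge addrC.
Qed.

Lemma gram_form_graded (U : set Omega) : graded_inner_product_on calc U ip.
Proof.
split=> [|k l w w' kl [kw _] [lw' _]]; last exact: gram_form_gr kl kw lw'.
by case: gram_form_inner => ip1 ip2 ip3; split=> *; [apply: ip1|apply: ip2|apply: ip3].
Qed.

(** Both forms being self-adjoint makes c real; both being unit vectors gives c^2 = 1. *)
Lemma volume_element_sign th : volume_element calc N ip th ->
  exists c : R[i], [/\ th = c *: theta, c^* = c & c * c = 1].
Proof.
case=> /theta_span[c ->] + /eqP; rewrite (conj_linearZ (gstar_conj_linear calc)) theta_star.
rewrite gram_formZl gram_formZr gram_form_theta mulr1 -subr_eq0 -scalerBl scaler_eq0.
rewrite -eT (negbTE (e_neq0 iT)) orbF subr_eq0 => cc /eqP cE.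
by exists c; split=> //; rewrite cE in cc.
Qed.

(** For c theta the integral and the Hodge operator are multiplied by c. The identities are linear
    in L or involve c only through c^2 = 1. *)
Lemma hodge_volume_element th : volume_element calc N ip th ->
  exists (int : {scalar Omega}) (L' : {linear Omega -> Omega}),
  [/\ is_integral calc h N th int, hodge_operator calc N ip int L', ip_unitary ip L'
    & [/\ forall k w, gr calc k w -> L' (L' w) = (- 1) ^+ (k * (N - k)) *: w,
          forall k w, gr calc k w -> L' (d w) = (- 1) ^+ k.+1 *: dstar (L' w)
        & [/\ forall w, dstar (d (L' w)) = L' (d (dstar w)),
              forall w, d (dstar (L' w)) = L' (dstar (d w))
            & forall w, L' (laplacian d dstar w) = laplacian d dstar (L' w)]]].
Proof.
move=> /volume_element_sign[c [-> cE c2]].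
have [int intE] : exists int : {scalar Omega}, int =1 fun w => c * integ w.
  by apply: scalar_pack => a u v; rewrite !linearP /= mulrDr mulrCA.
have [L' L'E] : exists L' : {linear Omega -> Omega}, L' =1 fun w => c *: L w.
  by apply: linear_pack => a u v; rewrite linearP scalerDr !scalerA mulrC.
have L'L' k w : gr calc k w -> L' (L' w) = (- 1) ^+ (k * (N - k)) *: w.
  by move=> kw; rewrite !L'E linearZ /= scalerA c2 scale1r; apply: hodge_hodge.
have L'gr k w : gr calc k w -> gr calc (N - k) (L' w).
  by move=> kw; rewrite L'E; apply: (subspaceZ (gr_subspace _ _)); apply: hodge_gr.
exists int, L'; split; [split|split|split|split] => //.
- by move=> k w kN kw; rewrite intE (integ_gr kw) ?mulr0 // ltn_eqF.
- by move=> a; rewrite intE -scalerAr !linearZ /= integ_theta mulrA c2 mul1r.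
- by move=> a w; rewrite !L'E hodge_incl scalerAr.
- move=> k kN; apply/seteqP; split=> [_ [w kw <-]|w kw]; first exact: L'gr.
  (* [L'] is its own inverse up to sign, so [L' w] with the sign of degree N - k is a preimage of
     w. *)
  exists ((- 1) ^+ ((N - k) * (N - (N - k))) *: L' w).
    apply: (subspaceZ (gr_subspace _ _)); rewrite -{1}(subKn kN); exact: L'gr.
  by rewrite linearZ /= (L'L' _ _ kw) scalerA -exprD addnn -mul2n exprM sqrrN !expr1n scale1r.
- by move=> w w'; rewrite intE L'E -scalerAr !linearZ /= integ_hodge mulrA c2 mul1r.
- apply: (eq_bij (f := fun w => c *: L w)) => [|w]; last by rewrite L'E.
  have scale_bij : bijective (fun w : Omega => c *: w).
    by exists (fun w => c *: w) => w; rewrite scalerA c2 scale1r.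
  exact: (bij_comp scale_bij hodge_bijective).
- by move=> u v; rewrite !L'E gram_formZl gram_formZr hodge_isometry cE mulrA c2 mul1r.
- by move=> k w kw; rewrite !L'E (codiff_hodge kw) [dstar (c *: _)]linearZ /= !scalerA mulrC.
- split=> w; rewrite !L'E.
  + by rewrite -codiff_extd_hodge !linearZ.
  + by rewrite -extd_codiff_hodge !linearZ.
  + by rewrite laplacian_hodge /laplacian !(linearZ, =^~ scalerDr).
Qed.

End HodgeOperator.
End Hodge.

Theorem theorem6p1 (R : realType) (A : algType (R[i]))
    (H : hopf_star_algebra A) (h : {scalar A}) (Omega : algType (R[i]))
    (calc : star_diff_calculus H Omega) (N : nat)
    (haar_h : haar_integral H h)
    (fin_calc : strongly_finite_dim calc)
    (dim_calc : calc_dim calc N)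
    (nondeg_calc : non_degenerate calc N)
    (dim_invN : has_dim (inv_gr calc N) 1)
    (extd_inv : forall k w, k.+1 = N -> inv_gr calc k w -> extd calc w = 0) :
  exists ip : Omega -> Omega -> R[i],
    graded_inner_product_on calc (inv_form calc) ip /\
  exists (ipO : Omega -> Omega -> R[i]) (dstar : {linear Omega -> Omega}),
    [/\ induced_inner_product calc h ip ipO,
        graded_inner_product_on calc setT ipO,
        ip_adjoint ipO (extd calc) dstar,
        exists theta, volume_element calc N ip theta
      & forall theta, volume_element calc N ip theta ->
        exists (integ : {scalar Omega}) (L : {linear Omega -> Omega}),
        [/\ is_integral calc h N theta integ,
            hodge_operator calc N ipO integ L,
            ip_unitary ipO L
          & [/\ forall k w, gr calc k w -> L (L w) = (- 1) ^+ (k * (N - k)) *: w,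
                forall k w, gr calc k w ->
                  L (extd calc w) = (- 1) ^+ k.+1 *: dstar (L w)
              & [/\ forall w, dstar (extd calc (L w)) = L (extd calc (dstar w)),
                    forall w, extd calc (dstar (L w)) = L (dstar (extd calc w))
                  & forall w, L (laplacian (extd calc) dstar w) =
                              laplacian (extd calc) dstar (L w)]]]].
Proof.
have [theta [theta_gr theta_neq0 theta_star theta1 theta_span]] := volume_form dim_invN.
have [n [e [dg [i0 [iT [e_basis e0 eT]]]]]] :=
  exists_homogeneous_basis fin_calc theta_gr theta_neq0 theta1.
have [C [coord_sum coord_basis]] := exists_coord e_basis.
have [||||||||E [Lm /= [E_unit M_L L_G_L L_L [G_gr L_gr G_T]]]] :=
  @hodge_matrix _ n dg N (pairing_mx (h := h) calc (e := e) (iT := iT) (C := C)) i0 iT.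
- by apply: dg_le; eassumption.
- by apply: pairing_gr; eassumption.
- by apply: pairing_conj; eassumption.
- by apply: pairing_unit; eassumption.
- by apply: dg0; eassumption.
- by apply: dgT; eassumption.
- by apply: pairing_T; eassumption.
- by apply: pairing_0; eassumption.
have [L LE] : exists L : {linear Omega -> Omega},
    L =1 fun w => \sum_j incl calc (C j w) * (\sum_k Lm k j *: e k).
  apply: linear_pack => c u v; rewrite scaler_sumr -big_split; apply: eq_bigr => j _ /=.
  by rewrite !linearP mulrDl scalerAl.
pose sg (m : nat) : R[i] := (- 1) ^+ ((N - m).+1 + m * (N - m)).
have [dstar dstarE] : exists dstar : {linear Omega -> Omega}, dstar =1 fun w =>
    L (extd calc (L (\sum_j sg (dg j) *: (incl calc (C j w) * e j)))).
  apply: linear_pack => c u v; rewrite -!linearP; do 3!congr (_ _).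
  rewrite scaler_sumr -big_split; apply: eq_bigr => j _ /=.
  by rewrite !linearP mulrDl scalerDr -scalerAl !scalerA mulrC.
exists (gram_form (h := h) (H := H) (C := C) (E := E)); split.
  by apply: gram_form_graded; eassumption.
exists (gram_form (h := h) (H := H) (C := C) (E := E)), dstar; split.
- split; first by apply: gram_form_inner; eassumption.
  by apply: gram_form_incl; eassumption.
- by apply: gram_form_graded; eassumption.
- by apply: codiff_adjoint; eassumption.
- exists theta; split=> //; by apply: gram_form_theta; eassumption.
- by apply: hodge_volume_element; eassumption.
Qed.
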